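(* Let $V$ be a vertex operator algebra. The associative algebra $\tilde A(V)$ is isomorphic to the associative algebra $A(V)$ constructed by Zhu.
   Context: $\operatorname{Res}_x$ denotes the coefficient of $x^{-1}$. For $u,v\in V$, $$u\bullet v=\operatorname{Res}_yy^{-1}Y\left(u,\frac1{2\pi i}\log(1+y)\right)v=\operatorname{Res}_x\frac{2\pi ie^{2\pi ix}}{e^{2\pi ix}-1}Y(u,x)v.$$ $\tilde O(V)$ is the subspace of $V$ spanned by the elements $$\operatorname{Res}_yy^{-n}Y\left(u,\frac1{2\pi i}\log(1+y)\right)v=\operatorname{Res}_x\frac{2\pi ie^{2\pi ix}}{(e^{2\pi ix}-1)^n}Y(u,x)v$$ for $n>1$ and $u,v\in V$; $\tilde A(V)=V/\tilde O(V)$ with the product induced by $\bullet$, which is an associative algebra with identity $\mathbf 1+\tilde O(V)$. Zhu's algebra: $A(V)=V/O(V)$, where $O(V)$ is the span of $\operatorname{Res}_yy^{-2}Y((1+y)^{L(0)}u,y)v$ for $u,v\in V$ (equivalently of all $\operatorname{Res}_yy^{-n}Y((1+y)^{L(0)}u,y)v$ with $n\ge2$), with the product induced by $u*v=\operatorname{Res}_yy^{-1}Y((1+y)^{L(0)}u,y)v$. *)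

(* Defs.v *)
From HB Require Import structures.
From mathcomp Require Import all_boot all_order all_algebra.
From mathcomp Require Import complex.
From mathcomp Require Import boolp classical_sets functions cardinality fsbigop.
From mathcomp Require Import reals trigo.

Set Implicit Arguments.
Unset Strict Implicit.
Unset Printing Implicit Defensive.

Import Order.TTheory GRing.Theory Num.Theory.

Local Open Scope classical_set_scope.
Local Open Scope ring_scope.
Local Open Scope complex_scope.

Definition lspan (K : pzRingType) (V : lmodType K) (S : set V) : set V :=
  [set v | exists (n : nat) (a : 'I_n -> K) (s : 'I_n -> V),
     (forall i, S (s i)) /\ v = \sum_(i < n) a i *: s i].

(* The binomial coefficient m (m - 1) ... (m - k + 1) / k!, m possibly
   negative: the coefficient of y^k in (1 + y)^m. *)
Definition zbinom (K : fieldType) (m : int) (k : nat) : K :=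
  (\prod_(i < k) (m - i%:Z)%:~R) / k`!%:R.

(* A formal power series is the sequence of its coefficients. *)
Section PowerSeries.
Variable K : fieldType.
Implicit Types f g : nat -> K.

Definition fps_one : nat -> K := fun n => (n == 0)%:R.

Definition fps_mul f g : nat -> K :=
  fun n => \sum_(i < n.+1) f i * g (n - i)%N.

Definition fps_exp f (k : nat) : nat -> K := iter k (fps_mul f) fps_one.

(* For f 0 != 0, with the geometric series
   1 / f = (f 0)^-1 \sum_k (1 - (f 0)^-1 f)^k;
   only the terms k <= n contribute to the coefficient of degree n. *)
Definition fps_inv f : nat -> K :=
  fun n => (f 0)^-1 *
    \sum_(k < n.+1) fps_exp (fun j => fps_one j - (f 0)^-1 * f j) k n.

End PowerSeries.

(* Vertex operator algebras in the sense of Frenkel-Lepowsky-Meurman and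
   Frenkel-Huang-Lepowsky.  The vertex operator map is given by its modes,
   Y(u, x) v = \sum_(n in Z) (vop u n v) x^(-n-1), and L(n) = omega_(n+1).
   All the sums over nat and int are finite, by truncation. *)
HB.mixin Record Lmodule_isVOA (R : realType) V of GRing.Lmodule R[i] V := {
  vop : V -> int -> V -> V;
  vacuum : V;
  conformal : V;
  central_charge : R[i];
  wt_space : int -> set V;
  (* V is the direct sum of the finite-dimensional subspaces wt_space n, which
     vanish for n sufficiently negative *)
  wt_space0 : forall n, wt_space n 0;
  wt_space_linear : forall n a u v,
    wt_space n u -> wt_space n v -> wt_space n (a *: u + v);
  wt_space_direct : forall v, exists! f : int -> V,
    [/\ forall n, wt_space n (f n),
        finite_set [set n | f n != 0]
      & v = \sum_(n \in [set: int]) f n];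
  wt_space_findim : forall n, exists s : seq V,
    wt_space n `<=` lspan [set` s];
  wt_space_bounded : exists N : int, forall n, n < N -> wt_space n `<=` [set 0];
  vop_linearl : forall n v, linear (fun u => vop u n v);
  vop_linearr : forall u n, linear (vop u n);
  vop_trunc : forall u v, exists N : int, forall n, N <= n -> vop u n v = 0;
  vop_vacuum : forall n v, vop vacuum n v = if n == -1 then v else 0;
  vop_creation_reg : forall v n, 0 <= n -> vop v n vacuum = 0;
  vop_creation : forall v, vop v (-1) vacuum = v;
  (* the coefficient of x0^(-l-1) x1^(-m-1) x2^(-n-1) in the Jacobi identity
       x0^-1 delta((x1 - x2) / x0) Y(u, x1) Y(v, x2) w
         - x0^-1 delta((x2 - x1) / - x0) Y(v, x2) Y(u, x1) w
       = x2^-1 delta((x1 - x0) / x2) Y(Y(u, x0) v, x2) w *)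
  vop_jacobi : forall (l m n : int) u v w,
    \sum_(i \in [set: nat]) ((-1) ^+ i * zbinom R[i] l i) *:
      (vop u (m + l - i%:Z) (vop v (n + i%:Z) w)
       - (-1) ^ l *: vop v (n + l - i%:Z) (vop u (m + i%:Z) w))
    = \sum_(i \in [set: nat]) zbinom R[i] m i *:
        vop (vop u (l + i%:Z) v) (m + n - i%:Z) w;
  vacuum_wt : wt_space 0 vacuum;
  conformal_wt : wt_space 2 conformal;
  virasoro : forall (m n : int) v,
    vop conformal (m + 1) (vop conformal (n + 1) v)
      - vop conformal (n + 1) (vop conformal (m + 1) v)
    = (m - n)%:~R *: vop conformal (m + n + 1) v
      + (if m + n == 0 then (m ^+ 3 - m)%:~R / 12%:R * central_charge else 0)
          *: v;
  L0_wt : forall n v, wt_space n v -> vop conformal 1 v = n%:~R *: v;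
  Lm1_derivative : forall u n v,
    vop (vop conformal 0 u) n v = - n%:~R *: vop u (n - 1) v
}.

#[short(type="voaType")]
HB.structure Definition VertexOperatorAlgebra (R : realType) :=
  {V of Lmodule_isVOA R V & GRing.Lmodule R[i] V}.

Section Products.
Variables (R : realType) (V : voaType R).
Implicit Types u v : V.

(* The homogeneous component of weight n of u. *)
Definition wt_comp u (n : int) : V := sval (cid (wt_space_direct u)) n.

(* Res_x x^(-n) h(x) Y(u, x) v *)
Definition res_vop (h : nat -> R[i]) (n : nat) u v : V :=
  \sum_(k \in [set: nat]) h k *: vop u (k%:Z - n%:Z) v.

Definition two_pi_i : R[i] := (2 * pi)%:C * 'i%C.

(* e^(2 pi i x) *)
Definition exp_2pi_i : nat -> R[i] := fun k => two_pi_i ^+ k / k`!%:R.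

(* (e^(2 pi i x) - 1) / x *)
Definition exp_2pi_i_sub1_divx : nat -> R[i] := fun k => exp_2pi_i k.+1.

(* Res_x (2 pi i e^(2 pi i x) / (e^(2 pi i x) - 1)^n) Y(u, x) v *)
Definition tilde_res (n : nat) u v : V :=
  res_vop (fun k => two_pi_i *
             fps_mul exp_2pi_i (fps_exp (fps_inv exp_2pi_i_sub1_divx) n) k)
          n u v.

Definition tilde_mul u v : V := tilde_res 1 u v.

Definition tilde_O : set V :=
  lspan [set w | exists (n : nat) (u v : V), (1 < n)%N /\ w = tilde_res n u v].

(* Res_y y^(-n) Y((1 + y)^L(0) u, y) v, where (1 + y)^L(0) acts on the
   homogeneous elements of weight m as (1 + y)^m *)
Definition zhu_res (n : nat) u v : V :=
  \sum_(m \in [set: int]) res_vop (zbinom R[i] m) n (wt_comp u m) v.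

Definition zhu_mul u v : V := zhu_res 1 u v.

Definition zhu_O : set V := lspan [set w | exists u v : V, w = zhu_res 2 u v].

End Products.

(* Associative unital algebras. The algType structure of the library is not
   used because it requires 1 != 0, which fails for V = 0. *)
Record assoc_algebra (K : pzRingType) := AssocAlgebra {
  alg_car :> lmodType K;
  alg_mul : alg_car -> alg_car -> alg_car;
  alg_one : alg_car;
  alg_mul_linearl : forall y, linear (fun x => alg_mul x y);
  alg_mul_linearr : forall x, linear (alg_mul x);
  alg_mulA : associative alg_mul;
  alg_mul1l : left_id alg_one alg_mul;
  alg_mul1r : right_id alg_one alg_mul
}.

Arguments alg_mul {K a} x y : rename.
Arguments alg_one {K a}.

Definition alg_isomorphic (K : pzRingType) (A B : assoc_algebra K) : Prop :=
  exists f : {linear A -> B},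
    [/\ bijective f,
        forall x y, f (alg_mul x y) = alg_mul (f x) (f y)
      & f alg_one = alg_one].

(* The associative algebra V / O with identity e + O and with the product
   induced by mul, presented by its canonical projection. It exists only if
   mul descends to V / O, where it is associative with identity e + O; it is
   then unique up to a unique isomorphism compatible with the projections. *)
Record quotient_algebra (K : pzRingType) (V : lmodType K) (O : set V)
    (mul : V -> V -> V) (e : V) := QuotientAlgebra {
  quot_alg :> assoc_algebra K;
  quot_proj : {linear V -> quot_alg};
  quot_proj_surj : forall a, exists v, quot_proj v = a;
  quot_proj_ker : forall v, quot_proj v = 0 <-> O v;
  quot_projM : forall u v,
    quot_proj (mul u v) = alg_mul (quot_proj u) (quot_proj v);
  quot_proj1 : quot_proj e = alg_one
}.

Definition tilde_algebra (R : realType) (V : voaType R) :=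
  quotient_algebra (@tilde_O R V) (@tilde_mul R V) vacuum.

Definition zhu_algebra (R : realType) (V : voaType R) :=
  quotient_algebra (@zhu_O R V) (@zhu_mul R V) vacuum.

(* Main.v *)
(* Put y = e^(2 pi i x) - 1. The residues defining the two algebras are those of
   Y(u, log (1 + y) / (2 pi i)) v and of Y((1 + y)^L(0) u, y) v, and the first
   algebra is carried to the second by the operator U = (exp of a sum of L(j),
   j > 0) (2 pi i)^L(0) that implements this change of coordinate on V.  The
   vector field x d/dx reads (1 + y) log (1 + y) d/dy = sum_(j >= 0) c_j
   y^(j+1) d/dy, so U is determined by E U = U L(0), where E = sum_j c_j L(j),
   together with its top weight part (2 pi i)^L(0).  The modes D_n of the
   difference between U Y(u, log (1 + y) / (2 pi i)) v and
   Y((1 + y)^L(0) U u, y) U v satisfy, for u, v of weights a, b,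
     E D_n = (a + b) D_n - sum_j c_j (j + 1 - n) D_(n - j),
   and D_n = 0 for n << 0.  By induction on n, E D_n = (a + b + n - 1) D_n; as all
   the weights in D_n are < a + b + n - 1 and E - L(0) lowers weights, D_n = 0.

   That Zhu's algebra is well defined follows from the formula for
   Z_m(Z_1(u, v), w) in terms of the modes Z_n(u, v) of Y((1 + y)^L(0) u, y) v,
   for m = 1 and m = 2. *)

From HB Require Import structures.
From mathcomp Require Import all_boot all_order all_algebra.
From mathcomp Require Import ring_quotient generic_quotient.
From mathcomp Require Import complex finmap.
From mathcomp Require Import boolp classical_sets functions cardinality fsbigop.
From mathcomp Require Import reals trigo.
From mathcomp Require Import zify ring.
Require Import Defs.

Set Implicit Arguments.
Unset Strict Implicit.
Unset Printing Implicit Defensive.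

Import Order.TTheory GRing.Theory Num.Theory.

Local Open Scope classical_set_scope.
Local Open Scope ring_scope.

(** * Finitely supported sums *)

(** Writing U as an explicit exponential and conjugating vertex operators by it would require
    composing formal series. The relation E U = U L(0) avoids this: it is linear in U and solvable
    degree by degree, and only commutators of L(j) with modes are ever computed. Let l(y) = (1 + y)
    log (1 + y). The coefficients c_j (j + 1 - n) arise on both sides from one integration by parts,
    Res y^(-n) l F' = - Res (l y^(-n))' F. On Zhu's side l F' comes from the commutator of E with
    modes; on the other side it comes from the weights of the modes and a recursion for the
    coefficients of q (q - 1)^(-n), q = e^(2 pi i x). The recursion passes from n to n - j and
    starts at n << 0, so residues of negative order are needed although only n >= 1 enters the two
    algebras. The tilde product is never shown directly to descend or to be associative: U is
    bijective and preserves the order of residues, so Zhu's projection composed with U already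
    presents the tilde algebra. *)

Section NatSums.
Variable V : zmodType.
Implicit Types F G : nat -> V.

(** An [fsbigop] sum has value 0 when its support is infinite, so the rearrangements below carry a
    hypothesis [fin1], [fin2] or [fin3]. The sums over nat in the axioms of a vertex operator
    algebra fold to this form. *)
Definition nsum F : V := \sum_(i \in [set: nat]) F i.

Definition fin1 F := exists N, forall i, (N <= i)%N -> F i = 0.
(** A bound on [i + j] is symmetric in the two indices and fits summation along antidiagonals. *)
Definition fin2 (F : nat -> nat -> V) :=
  exists N, forall i j, (N <= i + j)%N -> F i j = 0.

Lemma nsumE N F : (forall i, (N <= i)%N -> F i = 0) ->
  nsum F = \sum_(i < N) F i.
Proof.
move=> F0; rewrite /nsum (@fsbigE _ 0 +%R _ _ (iota 0 N)) ?iota_uniq //=.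
- by rewrite -[N in LHS]subn0 -/(index_iota 0 N) big_mkord big_mkcond /=; apply: eq_bigr => i _; rewrite in_setT.
- by move=> i _; rewrite mem_iota /= add0n -leqNgt => /F0.
Qed.

Lemma eq_nsum F G : F =1 G -> nsum F = nsum G.
Proof. by move=> /funext ->. Qed.

Lemma nsum_eq0 F : (forall i, F i = 0) -> nsum F = 0.
Proof. by move=> F0; rewrite (@nsumE 0) ?big_ord0. Qed.

Lemma nsum_shift p F : (forall i, (i < p)%N -> F i = 0) -> fin1 F ->
  nsum F = nsum (fun i => F (p + i)%N).
Proof.
move=> F0 [N FN].
rewrite (@nsumE (p + N)); last by move=> i Hi; apply: FN; lia.
rewrite (@nsumE N); last by move=> i Hi; apply: FN; lia.
by rewrite big_split_ord /= big1 ?add0r // => i _; exact: F0.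
Qed.

Lemma fin1D F G : fin1 F -> fin1 G -> fin1 (fun i => F i + G i).
Proof.
move=> [N FN] [M GM]; exists (N + M)%N => i Hi.
by rewrite FN ?GM ?addr0 //; lia.
Qed.

Lemma nsumD F G : fin1 F -> fin1 G ->
  nsum (fun i => F i + G i) = nsum F + nsum G.
Proof.
move=> [N FN] [M GM].
have F0 i : (N + M <= i)%N -> F i = 0 by move=> Hi; apply: FN; lia.
have G0 i : (N + M <= i)%N -> G i = 0 by move=> Hi; apply: GM; lia.
rewrite (nsumE F0) (nsumE G0) (@nsumE (N + M)) ?big_split //.
by move=> i Hi; rewrite F0 ?G0 ?addr0.
Qed.

Lemma fin1N F : fin1 F -> fin1 (fun i => - F i).
Proof. by move=> [N FN]; exists N => i Hi; rewrite FN ?oppr0. Qed.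

Lemma nsumN F : fin1 F -> nsum (fun i => - F i) = - nsum F.
Proof.
move=> [N FN]; rewrite (nsumE FN) (@nsumE N) ?sumrN // => i Hi.
by rewrite FN ?oppr0.
Qed.

Lemma nsumB F G : fin1 F -> fin1 G ->
  nsum (fun i => F i - G i) = nsum F - nsum G.
Proof. by move=> fF fG; rewrite nsumD ?nsumN //; exact: fin1N. Qed.

Lemma nsum1 p F : (forall i, i != p -> F i = 0) -> nsum F = F p.
Proof.
move=> F0; rewrite (@nsumE p.+1); last by move=> i Hi; apply: F0; lia.
by rewrite big_ord_recr /= big1 ?add0r // => i _; apply: F0; rewrite neq_ltn ltn_ord.
Qed.

Lemma nsum_recl F : fin1 F -> nsum F = F 0%N + nsum (fun i => F i.+1).
Proof.
move=> [N FN]; rewrite (@nsumE N.+1); last by move=> i Hi; apply: FN; lia.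
rewrite big_ord_recl /= (@nsumE N) // => i Hi; apply: FN; lia.
Qed.

Lemma fin1_S F : fin1 F -> fin1 (fun i => F i.+1).
Proof. by move=> [N FN]; exists N => i Hi; apply: FN; lia. Qed.

Lemma fin1_shift p F : fin1 F -> fin1 (fun i => F (p + i)%N).
Proof. by move=> [N FN]; exists N => i Hi; apply: FN; lia. Qed.

(** Only the rows [i < N] can be nonzero, and their finitely many bounds have a maximum. For nested
    modes the bound on a row depends on the vector produced by the inner mode, so no uniform bound
    is at hand. *)
Lemma fin2_intro (F : nat -> nat -> V) :
  (exists N, forall i j, (N <= i)%N -> F i j = 0) -> (forall i, fin1 (F i)) -> fin2 F.
Proof.
move=> [N FN] /choice[M FM]; exists (N + \max_(i < N) M i)%N => i j Hij.
have [Ni|iN] := leqP N i; first exact: FN.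
apply: FM; move: (@leq_bigmax _ (fun i : 'I_N => M i) (Ordinal iN)) Hij; set m := \max_(_ < _) _; rewrite /=; lia.
Qed.

Lemma fin2_sym (F : nat -> nat -> V) : fin2 F -> fin2 (fun i j => F j i).
Proof. by move=> [N FN]; exists N => i j; rewrite addnC; exact: FN. Qed.

Lemma fin2_l (F : nat -> nat -> V) : fin2 F -> forall i, fin1 (F i).
Proof. by move=> [N FN] i; exists N => j Hj; apply: FN; lia. Qed.

Lemma fin2_nsum (F : nat -> nat -> V) : fin2 F -> fin1 (fun i => nsum (F i)).
Proof.
move=> [N FN]; exists N => i Hi; apply: nsum_eq0 => j; apply: FN; lia.
Qed.

Lemma nsum2E N (F : nat -> nat -> V) :
    (forall i j, (N <= i + j)%N -> F i j = 0) ->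
  nsum (fun i => nsum (F i)) = \sum_(i < N) \sum_(j < N) F i j.
Proof.
move=> FN; rewrite (@nsumE N); last first.
  move=> i Hi; apply: nsum_eq0 => j; apply: FN; lia.
by apply: eq_bigr => i _; rewrite (@nsumE N) // => j Hj; apply: FN; lia.
Qed.

Lemma nsum_exchange (F : nat -> nat -> V) : fin2 F ->
  nsum (fun i => nsum (F i)) = nsum (fun j => nsum (F^~ j)).
Proof.
move=> [N FN]; rewrite (nsum2E FN) exchange_big (@nsum2E N) // => i j.
by rewrite addnC; exact: FN.
Qed.

Lemma nsum_diag (F : nat -> nat -> V) : fin2 F ->
  nsum (fun i => nsum (F i)) = nsum (fun s => \sum_(i < s.+1) F i (s - i)%N).
Proof.
move=> [N FN]; rewrite (nsum2E FN) (@nsumE N); last first.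
  by move=> s Hs; apply: big1 => i _; apply: FN; have := ltn_ord i; lia.
(* The inner range is widened to [i < N] under the condition [i <= s], so that the two finite sums
   can be exchanged; then s is replaced by i + j. *)
under [RHS]eq_bigr => s _.
  rewrite (big_ord_widen N (fun i => F i (s - i)%N)) ?ltn_ord //.
  over.
rewrite [RHS](exchange_big_dep predT) //=; apply: eq_bigr => i _.
rewrite -(big_mkord predT (F i)) (big_cat_nat _ (n := N - i)) //=; last lia.
rewrite [X in _ + X]big_nat_cond [X in _ + X]big1 ?addr0; last first.
  by move=> j /andP[/andP[Hj _] _]; apply: FN; lia.
rewrite -(big_mkord (fun s => (i < s.+1)%N) (fun s => F i (s - i)%N)).
rewrite [RHS](big_cat_nat _ (n := i)) //=; last by rewrite ltnW.
rewrite [X in _ = X + _]big_nat_cond [X in _ = X + _]big1 ?add0r; last first.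
  by move=> j /andP[/andP[_ Hj]]; lia.
rewrite -{3}[nat_of_ord i]add0n.
rewrite big_addn.
by rewrite big_nat_cond [RHS]big_nat_cond; apply: eq_big => [j|j _]; rewrite ?addnK ?andbT //; lia.
Qed.

Definition fin3 (F : nat -> nat -> nat -> V) :=
  exists N, forall i j k, (N <= i + j + k)%N -> F i j k = 0.

Lemma fin3_intro (F : nat -> nat -> nat -> V) :
  (exists N, forall i j k, (N <= j + k)%N -> F i j k = 0) ->
  (forall j k, fin1 (fun i => F i j k)) -> fin3 F.
Proof.
move=> [N FN] F1.
have /choice[M FM] : forall x : nat * nat, exists M, forall i, (M <= i)%N -> F i x.1 x.2 = 0.
  by move=> x; exact: F1.
exists (N + \sum_(j < N) \sum_(k < N) M (nat_of_ord j, nat_of_ord k))%N => i j k Hijk.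
have [Njk|jkN] := leqP N (j + k); first exact: FN.
have jN : (j < N)%N by lia.
have kN : (k < N)%N by lia.
apply: (FM (j, k)); move: Hijk; rewrite (bigD1 (Ordinal jN)) //= (bigD1 (Ordinal kN)) //=.
lia.
Qed.

Lemma fin3_intro_l (F : nat -> nat -> nat -> V) :
  (exists N, forall i j k, (N <= i)%N -> F i j k = 0) ->
  (forall i, fin2 (F i)) -> fin3 F.
Proof.
move=> [N FN] /choice[M FM]; exists (N + \sum_(i < N) M i)%N => i j k Hijk.
have [Ni|iN] := leqP N i; first exact: FN.
by apply: FM; move: Hijk; rewrite (bigD1 (Ordinal iN)) //=; lia.
Qed.

Lemma fin3_rot (F : nat -> nat -> nat -> V) : fin3 F -> fin3 (fun k i j => F i j k).
Proof. by move=> [N FN]; exists N => k i j H; apply: FN; lia. Qed.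

Lemma fin3_l (F : nat -> nat -> nat -> V) : fin3 F -> forall i, fin2 (F i).
Proof. by move=> [N FN] i; exists N => j k H; apply: FN; lia. Qed.

Lemma fin3_nsum (F : nat -> nat -> nat -> V) : fin3 F ->
  fin2 (fun i j => nsum (F i j)).
Proof.
by move=> [N FN]; exists N => i j H; apply: nsum_eq0 => k; apply: FN; lia.
Qed.

Lemma nsum3_rot (F : nat -> nat -> nat -> V) : fin3 F ->
  nsum (fun i => nsum (fun j => nsum (F i j))) =
  nsum (fun k => nsum (fun i => nsum (fun j => F i j k))).
Proof.
move=> F3; transitivity (nsum (fun i => nsum (fun k => nsum (fun j => F i j k)))).
  by apply: eq_nsum => i; apply: nsum_exchange; exact: fin3_l.
apply: nsum_exchange; have [N FN] := F3; exists N => i k H.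
by apply: nsum_eq0 => j; apply: FN; lia.
Qed.

Lemma fin1_sum n (F : 'I_n -> nat -> V) : (forall i, fin1 (F i)) ->
  fin1 (fun k => \sum_(i < n) F i k).
Proof.
move=> /choice[M FM]; exists (\sum_(i < n) M i)%N => k Hk.
apply: big1 => i _; apply: FM; move: Hk; rewrite (bigD1 i) //=; lia.
Qed.

Lemma nsum_sum n (F : 'I_n -> nat -> V) : (forall i, fin1 (F i)) ->
  \sum_(i < n) nsum (F i) = nsum (fun k => \sum_(i < n) F i k).
Proof.
elim: n F => [|n IHn] F F1.
  by rewrite big_ord0 nsum_eq0 // => k; rewrite big_ord0.
rewrite big_ord_recl IHn // -nsumD //; last exact: fin1_sum.
by apply: eq_nsum => k; rewrite big_ord_recl.
Qed.

End NatSums.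

Lemma nsum_morph (V W : zmodType) (f : V -> W) (F : nat -> V) :
  f 0 = 0 -> {morph f : x y / x + y} -> fin1 F -> f (nsum F) = nsum (f \o F).
Proof.
move=> f0 fD [N FN]; rewrite (nsumE FN) (@nsumE _ N) ?(big_morph f fD f0) //.
by move=> i Hi /=; rewrite FN.
Qed.

Lemma fin1_morph (V W : zmodType) (f : V -> W) (F : nat -> V) :
  f 0 = 0 -> fin1 F -> fin1 (f \o F).
Proof. by move=> f0 [N FN]; exists N => i Hi /=; rewrite FN. Qed.

Section LmodSums.
Variables (K : pzRingType) (V : lmodType K).

Lemma nsumZ (a : K) (F : nat -> V) : fin1 F ->
  nsum (fun i => a *: F i) = a *: nsum F.
Proof.
move=> fF; rewrite (@nsum_morph _ _ ( *:%R a)) ?scaler0 //.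
by move=> x y; rewrite scalerDr.
Qed.

Lemma fin1Z (a : nat -> K) (F : nat -> V) : fin1 F -> fin1 (fun i => a i *: F i).
Proof. by move=> [N FN]; exists N => i Hi; rewrite FN ?scaler0. Qed.

Lemma fin2Z (a : nat -> nat -> K) (F : nat -> nat -> V) : fin2 F ->
  fin2 (fun i j => a i j *: F i j).
Proof. by move=> [N FN]; exists N => i j Hi; rewrite FN ?scaler0. Qed.

Lemma fin3Z (a : nat -> nat -> nat -> K) (F : nat -> nat -> nat -> V) : fin3 F ->
  fin3 (fun i j k => a i j k *: F i j k).
Proof. by move=> [N FN]; exists N => i j k Hi; rewrite FN ?scaler0. Qed.

End LmodSums.

(** * Binomial coefficients *)

Section Zbinom.
Variable K : fieldType.
Hypothesis charK0 : [pchar K] =i pred0.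
Implicit Types (m a b : int) (k i p s : nat).
Local Notation C := (zbinom K).

Let natrS_neq0 n : n.+1%:R != 0 :> K.
Proof. by move/pcharf0P: charK0 => ->. Qed.

Let fact_neq0 k : k`!%:R != 0 :> K.
Proof. by move/pcharf0P: charK0 => ->; rewrite -lt0n fact_gt0. Qed.

Lemma zbinom0 m : C m 0 = 1.
Proof. by rewrite /zbinom big_ord0 divr1. Qed.

(** After clearing denominators, a falling factorial of length [i + p] splits after its first i
    factors; the recurrences in k and the trinomial identity are read off from this. *)
Lemma zbinomD m i p :
  C m (i + p) * (i + p)`!%:R = (C m i * i`!%:R) * (C (m - i%:Z) p * p`!%:R).
Proof.
rewrite /zbinom !divfK ?fact_neq0 // big_split_ord /=; congr (_ * _).
by apply: eq_bigr => j _; rewrite PoszD opprD addrA.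
Qed.

Lemma zbinom1 m : C m 1 = m%:~R.
Proof. by rewrite /zbinom big_ord1 subr0 divr1. Qed.

Lemma zbinomSr m k : C m k.+1 * k.+1%:R = C m k * (m - k%:Z)%:~R.
Proof.
have := zbinomD m k 1; rewrite addn1 zbinom1 mulr1 factS natrM mulrA => E.
by apply: (mulIf (fact_neq0 k)); rewrite E; ring.
Qed.

Lemma zbinomSl m k : C m k.+1 * k.+1%:R = m%:~R * C (m - 1) k.
Proof.
have := zbinomD m 1 k; rewrite add1n zbinom1 mulr1 factS natrM !mulrA => E.
by apply: (mulIf (fact_neq0 k)); rewrite E.
Qed.

Lemma zbinom_pascal m k : C (m + 1) k.+1 = C m k.+1 + C m k.
Proof.
apply: (mulIf (natrS_neq0 k)); rewrite zbinomSl mulrDl zbinomSr addrK -mulrDr mulrC.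
by congr (_ * _); rewrite -[k.+1%:R]/(k.+1%:~R) -rmorphD /=; congr (_%:~R); lia.
Qed.

Lemma zbinom_nat (n k : nat) : C n k = 'C(n, k)%:R.
Proof.
elim: n k => [|n IHn] [|k]; rewrite ?zbinom0 ?bin0 //.
  by rewrite /zbinom big_ord_recl /= !mul0r.
by rewrite -addn1 PoszD zbinom_pascal !IHn addn1 binS natrD.
Qed.

Lemma zbinom_small (n k : nat) : (n < k)%N -> C n k = 0.
Proof. by move=> ?; rewrite zbinom_nat bin_small. Qed.

Lemma zbinom_trinomial a i p :
  C a (i + p) * C (i + p)%N i = C a i * C (a - i%:Z) p.
Proof.
have H : C (i + p)%N i * i`!%:R * p`!%:R = (i + p)`!%:R.
  by rewrite zbinom_nat -!natrM -mulnA -{2}(addKn i p) bin_fact ?leq_addr.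
apply: (mulIf (fact_neq0 p)); apply: (mulIf (fact_neq0 i)).
transitivity (C a (i + p) * (C (i + p)%N i * i`!%:R * p`!%:R)); first by ring.
by rewrite H zbinomD; ring.
Qed.

Lemma zbinom_negS i r : C (- i.+1%:Z) r = (-1) ^+ r * 'C(i + r, r)%:R.
Proof.
elim: r => [|r IHr]; first by rewrite zbinom0 bin0 mulr1.
apply: (mulIf (natrS_neq0 r)); rewrite zbinomSr IHr.
have -> : (- i.+1%:Z - r%:Z)%:~R = - (i + r).+1%:R :> K.
  by rewrite -[(i + r).+1%:R]/((i + r).+1%:~R) -rmorphN /=; congr (_%:~R); lia.
have E : (r.+1 * 'C(i + r.+1, r.+1) = (i + r).+1 * 'C(i + r, r))%N.
  by rewrite addnS mul_bin_diag.
rewrite -[RHS]mulrA -natrM [('C(_, _) * _)%N]mulnC E natrM exprS; ring.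
Qed.

(** Both sides obey Pascal's rule in a, which allows induction on a in both directions from 0. Going
    down, the rule gives the value at s + 1 only through the one at s, whence the inner induction on
    s. *)
Lemma zbinom_vandermonde a b s :
  \sum_(i < s.+1) C a i * C b (s - i)%N = C (a + b) s.
Proof.
pose W a s := \sum_(i < s.+1) C a i * C b (s - i)%N.
have WS a' s' : W (a' + 1) s'.+1 = W a' s'.+1 + W a' s'.
  rewrite /W [LHS]big_ord_recl [in RHS]big_ord_recl /= !zbinom0 -addrA; congr (_ + _).
  by rewrite -big_split /=; apply: eq_bigr => i _; rewrite zbinom_pascal mulrDl.
have W0 a' : W a' 0 = 1 by rewrite /W big_ord1 !zbinom0 mulr1.
rewrite -/(W a s); elim/int_rec: a s => [|n IHn|n IHn] s.
- rewrite add0r /W big_ord_recl zbinom0 mul1r subn0 big1 ?addr0 // => i _.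
  by rewrite (zbinom_small (n := 0)) ?mul0r.
- case: s => [|s]; rewrite ?W0 ?zbinom0 // -addn1 PoszD WS !IHn.
  by rewrite addrAC zbinom_pascal.
elim: s => [|s IHs]; first by rewrite W0 zbinom0.
have En : - n.+1%:Z + 1 = - n%:Z by lia.
have := WS (- n.+1%:Z) s; rewrite En IHn IHs.
move/(congr1 (fun x => x - C (- n.+1%:Z + b) s)); rewrite addrK => <-.
by rewrite -En addrAC zbinom_pascal addrK.
Qed.

End Zbinom.

(** * Sums of finite support over an arbitrary index type *)

Section FiniteSupport.
Variables (I : choiceType) (W : zmodType).
Implicit Types f g : I -> W.

Definition finsupp f := finite_set [set n | f n != 0].

Lemma finsuppD f g : finsupp f -> finsupp g -> finsupp (fun n => f n + g n).
Proof.
move=> ff fg; have fU : finite_set ([set n | f n != 0] `|` [set n | g n != 0]).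
  by rewrite finite_setU.
apply: sub_finite_set fU => n /=; have [->|] := eqVneq (f n) 0; last by left.
by rewrite add0r; right.
Qed.

Lemma fsumD f g : finsupp f -> finsupp g ->
  \sum_(n \in [set: I]) (f n + g n) =
  \sum_(n \in [set: I]) f n + \sum_(n \in [set: I]) g n.
Proof.
move=> ff fg; have fU : finite_set ([set n | f n != 0] `|` [set n | g n != 0]).
  by rewrite finite_setU.
have E (h : I -> W) : (forall n, f n = 0 -> g n = 0 -> h n = 0) ->
    \sum_(n \in [set: I]) h n =
    \sum_(n <- fset_set ([set n | f n != 0] `|` [set n | g n != 0])) h n.
  move=> h0; apply: fsbigTE => i; rewrite in_fset_set // notin_setE /= => /not_orP[].
  by move=> /negP; rewrite negbK => /eqP Ef /negP; rewrite negbK => /eqP; exact: h0.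
rewrite !E ?big_split // => n -> ->.
by rewrite addr0.
Qed.

Lemma fsum1 m f : (forall n, n != m -> f n = 0) -> \sum_(n \in [set: I]) f n = f m.
Proof.
move=> f0; rewrite (@fsbigTE _ _ _ _ [fset m]%fset) ?big_seq_fset1 // => i.
by rewrite inE; exact: f0.
Qed.

Lemma finsupp1 m f : (forall n, n != m -> f n = 0) -> finsupp f.
Proof.
move=> f0; apply: (sub_finite_set _ (finite_set1 m)) => n /=.
by apply: contraNeq => /f0 ->.
Qed.

End FiniteSupport.

Lemma fsum_morph (I : choiceType) (W W' : zmodType) (h : W -> W') (f : I -> W) :
  h 0 = 0 -> {morph h : x y / x + y} -> finsupp f ->
  h (\sum_(n \in [set: I]) f n) = \sum_(n \in [set: I]) h (f n).
Proof.
move=> h0 hD ff.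
have E (X : zmodType) (g : I -> X) : (forall n, f n = 0 -> g n = 0) ->
    \sum_(n \in [set: I]) g n = \sum_(n <- fset_set [set n | f n != 0]) g n.
  move=> g0; apply: fsbigTE => i; rewrite in_fset_set // notin_setE /=.
  by move=> /negP; rewrite negbK => /eqP; exact: g0.
rewrite (E W f) // (E W' (h \o f)) ?(big_morph h hD h0) // => n /= ->.
exact: h0.
Qed.

Lemma finsupp_morph (I : choiceType) (W W' : zmodType) (h : W -> W') (f : I -> W) :
  h 0 = 0 -> finsupp f -> finsupp (h \o f).
Proof.
move=> h0 ff; apply: sub_finite_set ff => n /=.
by apply: contraNneq => /= ->; rewrite h0.
Qed.

(** * Modes and weights *)

Section Modes.
Variables (R : realType) (V : voaType R).
Local Notation K := (R[i]).
Local Notation C := (zbinom K).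
Implicit Types u v w z : V.

Lemma charC0 : [pchar K] =i pred0.
Proof. exact: pchar_num. Qed.

HB.instance Definition _ u n := GRing.isLinear.Build K V V *:%R (vop u n) (vop_linearr u n).

Lemma vopDl n v u u' : vop (u + u') n v = vop u n v + vop u' n v.
Proof. by have := vop_linearl n v 1 u u'; rewrite !scale1r. Qed.

Lemma vop0l n v : vop 0 n v = 0.
Proof. by apply: (addrI (vop 0 n v)); rewrite -vopDl !addr0. Qed.

Lemma vopZl n v a u : vop (a *: u) n v = a *: vop u n v.
Proof. by have := vop_linearl n v a u 0; rewrite vop0l !addr0. Qed.

Lemma vop0r u n : vop u n 0 = 0. Proof. exact: raddf0. Qed.

Definition Lop (j : int) v : V := vop conformal (j + 1) v.

Lemma vopDr u n v v' : vop u n (v + v') = vop u n v + vop u n v'.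
Proof. exact: raddfD. Qed.

Lemma vopZr u n a v : vop u n (a *: v) = a *: vop u n v.
Proof. exact: linearZ_LR. Qed.

Lemma LopD j u v : Lop j (u + v) = Lop j u + Lop j v.
Proof. exact: vopDr. Qed.

Lemma LopZ j a v : Lop j (a *: v) = a *: Lop j v.
Proof. exact: vopZr. Qed.

Lemma Lop0r j : Lop j 0 = 0.
Proof. exact: vop0r. Qed.

Lemma vop_trunc_nat u v : exists N : nat, forall n : int, N%:Z <= n -> vop u n v = 0.
Proof.
have [N uv0] := vop_trunc u v; exists `|N|%N => n Nn; apply: uv0; lia.
Qed.

Lemma fin1_vop u v (n : int) : fin1 (fun k : nat => vop u (k%:Z + n) v).
Proof. have [N uv0] := vop_trunc_nat u v; exists (N + `|n|)%N => k Hk; apply: uv0; lia. Qed.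

Lemma vop_commutator (m n : int) u v w :
  vop u m (vop v n w) - vop v n (vop u m w) =
  nsum (fun i => C m i *: vop (vop u i v) (m + n - i%:Z) w).
Proof.
have := vop_jacobi 0 m n u v w; rewrite -!/(nsum _) (@nsum1 _ 0%N) => [|i i0].
  rewrite -[0%N%:Z]/(0 : int) mul1r zbinom0 expr0z !scale1r !addr0 => ->.
  by apply: eq_nsum => i; rewrite add0r.
by rewrite (@zbinom_small _ charC0 0) ?mulr0 ?scale0r ?lt0n.
Qed.

(** The case l = -1 of the Jacobi identity: [(-1) ^+ i * C (-1) i] is 1, and the sign [(-1) ^ l]
    turns the difference of products into a sum. *)
Lemma vop_associator (p n : int) u v w :
  nsum (fun i => C p i *: vop (vop u (i%:Z - 1) v) (p + n - i%:Z) w) =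
  nsum (fun i => vop u (p - 1 - i%:Z) (vop v (n + i%:Z) w)
                 + vop v (n - 1 - i%:Z) (vop u (p + i%:Z) w)).
Proof.
have := vop_jacobi (-1) p n u v w; rewrite -!/(nsum _) => E.
rewrite (eq_nsum (G := fun i => C p i *: vop (vop u (-1 + i%:Z) v) (p + n - i%:Z) w)); last first.
  by move=> i; rewrite addrC.
rewrite -E; apply: eq_nsum => i.
have -> : C (-1) i = (-1) ^+ i.
  by have := zbinom_negS charC0 0 i; rewrite add0n binn mulr1.
rewrite -exprMn mulrNN mulr1 expr1n scale1r.
by rewrite -[(-1) ^ _]/(-1)^-1 invrN1 scaleN1r opprK.
Qed.

Lemma Lop_commutator (j p : int) w z :
  Lop j (vop w p z) - vop w p (Lop j z) =
  nsum (fun i => C (j + 1) i *: vop (Lop (i%:Z - 1) w) (j + 1 + p - i%:Z) z).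
Proof. by rewrite /Lop vop_commutator; apply: eq_nsum => i; rewrite subrK. Qed.

Lemma vop_Lm1 u n v : vop (Lop (-1) u) n v = - n%:~R *: vop u (n - 1) v.
Proof. exact: Lm1_derivative. Qed.

Lemma Lop_trunc v : exists N : nat, forall j : int, N%:Z <= j -> Lop j v = 0.
Proof.
have [N H] := vop_trunc_nat conformal v; exists N => j Hj; apply: H; lia.
Qed.

Lemma Lop0_commutator p w z :
  Lop 0 (vop w p z) - vop w p (Lop 0 z) =
  vop (Lop 0 w) p z - (p + 1)%:~R *: vop w p z.
Proof.
rewrite Lop_commutator (@nsumE _ 2); last first.
  by move=> i Hi; rewrite -[0 + 1]/(1%:Z) zbinom_small ?scale0r //; exact: charC0.
rewrite !big_ord_recl big_ord0 /= zbinom0 zbinom1 !scale1r addr0 addrC.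
rewrite vop_Lm1 !add0r subrr -scaleNr; congr (_ + _).
  by rewrite addr0; congr (vop _ _ _); rewrite /bump /=; lia.
by congr (- _%:~R *: vop _ _ _); lia.
Qed.

Lemma Lop0_wt n v : wt_space n v -> Lop 0 v = n%:~R *: v.
Proof. exact: L0_wt. Qed.

Lemma wt_spaceD n u v : wt_space n u -> wt_space n v -> wt_space n (u + v).
Proof. by move=> nu nv; rewrite -[u]scale1r; exact: wt_space_linear. Qed.

Lemma wt_spaceZ n a u : wt_space n u -> wt_space n (a *: u).
Proof. by move=> nu; rewrite -[_ *: _]addr0; apply: wt_space_linear => //; exact: wt_space0. Qed.

Lemma wt_compP v :
  [/\ forall n, wt_space n (wt_comp v n), finsupp (wt_comp v)
    & v = \sum_(n \in [set: int]) wt_comp v n].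
Proof. by rewrite /wt_comp; case: cid => f [] /=. Qed.

Lemma wt_comp_uniq v f : (forall n, wt_space n (f n)) -> finsupp f ->
  v = \sum_(n \in [set: int]) f n -> wt_comp v = f.
Proof.
move=> f1 f2 f3; rewrite /wt_comp; case: cid => g [_ guniq] /=.
exact: guniq.
Qed.

Lemma wt_comp_hom m v : wt_space m v ->
  wt_comp v = fun n => if n == m then v else 0.
Proof.
move=> mv.
have v0 n : n != m -> (if n == m then v else 0) = 0 by move=> /negPf ->.
apply: wt_comp_uniq.
- by move=> n; case: eqP => [->//|_]; exact: wt_space0.
- exact: finsupp1 v0.
- by rewrite (fsum1 v0) eqxx.
Qed.

Lemma wt_compD u v n : wt_comp (u + v) n = wt_comp u n + wt_comp v n.
Proof.
have [u1 u2 u3] := wt_compP u; have [v1 v2 v3] := wt_compP v.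
rewrite (@wt_comp_uniq _ (fun n => wt_comp u n + wt_comp v n)) //.
- by move=> k; exact: wt_spaceD.
- exact: finsuppD.
- by rewrite fsumD // -u3 -v3.
Qed.

Lemma wt_compZ a v n : wt_comp (a *: v) n = a *: wt_comp v n.
Proof.
have [v1 v2 v3] := wt_compP v.
rewrite (@wt_comp_uniq _ (fun n => a *: wt_comp v n)) //.
- by move=> k; exact: wt_spaceZ.
- by apply: (@finsupp_morph _ _ _ ( *:%R a)) v2; rewrite scaler0.
- rewrite {1}v3 (@fsum_morph _ _ _ ( *:%R a)) ?scaler0 //.
  by move=> x y; rewrite scalerDr.
Qed.

Lemma wt_comp0 n : wt_comp (0 : V) n = 0.
Proof. by have := wt_compZ 0 0 n; rewrite !scale0r. Qed.

Lemma wt_comp_seq v : exists s : seq int, v = \sum_(n <- s) wt_comp v n.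
Proof.
have [_ v2 v3] := wt_compP v; exists (fset_set [set n | wt_comp v n != 0]).
rewrite {1}v3; apply: fsbigTE => i; rewrite in_fset_set // notin_setE /=.
by move=> /negP; rewrite negbK => /eqP.
Qed.

Lemma hom_ind (P : V -> Prop) : P 0 -> (forall x y, P x -> P y -> P (x + y)) ->
  (forall n x, wt_space n x -> P x) -> forall v, P v.
Proof.
move=> P0 PD Phom v; have [s ->] := wt_comp_seq v.
elim/big_ind: _ => // n _; apply: (Phom n); by have [] := wt_compP v.
Qed.

Lemma wt_comp_eq0 v : (forall n, wt_comp v n = 0) -> v = 0.
Proof. by move=> v0; have [s ->] := wt_comp_seq v; rewrite big1. Qed.

Lemma Lop0_comp v n : wt_comp (Lop 0 v) n = n%:~R *: wt_comp v n.
Proof.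
elim/hom_ind: v n => [|x y Px Py|m x mx] n.
- by rewrite Lop0r wt_comp0 scaler0.
- by rewrite LopD !wt_compD Px Py scalerDr.
rewrite (Lop0_wt mx) wt_compZ (wt_comp_hom mx); case: eqP => [->//|_].
by rewrite !scaler0.
Qed.

(** L(0) multiplies the component of weight n both by n and by m, and integers embed injectively in
    characteristic 0. *)
Lemma eigen_wt m v : Lop 0 v = m%:~R *: v -> wt_space m v.
Proof.
move=> Ev; have [v1 v2 v3] := wt_compP v.
have v0 n : n != m -> wt_comp v n = 0.
  move=> nm; have := Lop0_comp v n; rewrite Ev wt_compZ => /eqP.
  rewrite -subr_eq0 -scalerBl scaler_eq0 => /orP[|/eqP //].
  by rewrite subr_eq0 => /eqP /intr_inj E; rewrite E eqxx in nm.
by rewrite v3 (fsum1 v0).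
Qed.

(** The grading of the modes comes from their commutator with L(0), which makes [vop u n v] an
    eigenvector of L(0). *)
Lemma vop_wt a b n u v : wt_space a u -> wt_space b v ->
  wt_space (a + b - n - 1) (vop u n v).
Proof.
move=> au bv; apply: eigen_wt.
have := Lop0_commutator n u v; rewrite (Lop0_wt au) (Lop0_wt bv) => /eqP.
rewrite subr_eq => /eqP ->; rewrite vopZl vopZr -scalerBl -scalerDl.
by congr (_ *: _); rewrite -rmorphB -rmorphD /=; congr (_%:~R); lia.
Qed.

Lemma Lop_wt a j v : wt_space a v -> wt_space (a - j) (Lop j v).
Proof.
move=> av; have := vop_wt (j + 1) conformal_wt av.
by congr wt_space; lia.
Qed.

End Modes.

(** * Zhu's product *)

Section ZhuModes.
Variables (R : realType) (V : voaType R).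
Local Notation K := (R[i]).
Local Notation C := (zbinom K).
Implicit Types u v w z : V.

Definition hmode (m n : int) u v : V :=
  nsum (fun k => C m k *: vop u (k%:Z - n) v).

(* zhu_res with n possibly negative *)
Definition zmode (n : int) u v : V :=
  \sum_(m \in [set: int]) hmode m n (wt_comp u m) v.

Lemma zhu_resE (n : nat) u v : zhu_res n u v = zmode n u v.
Proof. by []. Qed.

Lemma fin1_hmode m n u v : fin1 (fun k => C m k *: vop u (k%:Z - n) v).
Proof. by apply: fin1Z; exact: fin1_vop. Qed.

Lemma hmodeDl m n u u' v : hmode m n (u + u') v = hmode m n u v + hmode m n u' v.
Proof.
rewrite /hmode -nsumD; [|exact: fin1_hmode..].
by apply: eq_nsum => k; rewrite vopDl scalerDr.
Qed.

Lemma hmodeZl m n a u v : hmode m n (a *: u) v = a *: hmode m n u v.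
Proof.
rewrite /hmode -nsumZ; last exact: fin1_hmode.
by apply: eq_nsum => k; rewrite vopZl !scalerA mulrC.
Qed.

Lemma hmode0l m n v : hmode m n 0 v = 0.
Proof. by apply: nsum_eq0 => k; rewrite vop0l scaler0. Qed.

Lemma zmode_hom m n u v : wt_space m u -> zmode n u v = hmode m n u v.
Proof.
move=> mu; rewrite /zmode (wt_comp_hom mu) (@fsum1 _ _ m) ?eqxx // => k /negPf ->.
exact: hmode0l.
Qed.

Lemma finsupp_hmode n u v : finsupp (fun m => hmode m n (wt_comp u m) v).
Proof.
have [_ H _] := wt_compP u; apply: sub_finite_set H => m /=.
by apply: contraNneq => ->; rewrite hmode0l.
Qed.

Lemma zmodeDl n u u' v : zmode n (u + u') v = zmode n u v + zmode n u' v.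
Proof.
rewrite /zmode -fsumD; [|exact: finsupp_hmode..].
by apply: eq_fsbigr => m _; rewrite wt_compD hmodeDl.
Qed.

Lemma zmodeZl n a u v : zmode n (a *: u) v = a *: zmode n u v.
Proof.
rewrite /zmode (@fsum_morph _ _ _ ( *:%R a)) ?scaler0 //.
- by apply: eq_fsbigr => m _; rewrite wt_compZ hmodeZl.
- by move=> x y; rewrite scalerDr.
- exact: finsupp_hmode.
Qed.

Lemma zmode0l n v : zmode n 0 v = 0.
Proof. by have := zmodeZl n 0 0 v; rewrite !scale0r. Qed.

Lemma zmodeDr n u v v' : zmode n u (v + v') = zmode n u v + zmode n u v'.
Proof.
elim/hom_ind: u => [|x y Px Py|m x mx]; rewrite ?zmode0l ?addr0 //.
  by rewrite !zmodeDl Px Py addrACA.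
rewrite !(zmode_hom _ _ mx) /hmode -nsumD; [|exact: fin1_hmode..].
by apply: eq_nsum => k; rewrite vopDr scalerDr.
Qed.

Lemma zmodeZr n a u v : zmode n u (a *: v) = a *: zmode n u v.
Proof.
elim/hom_ind: u => [|x y Px Py|m x mx]; rewrite ?zmode0l ?scaler0 //.
  by rewrite !zmodeDl Px Py scalerDr.
rewrite !(zmode_hom _ _ mx) /hmode -nsumZ; last exact: fin1_hmode.
by apply: eq_nsum => k; rewrite vopZr !scalerA mulrC.
Qed.

Lemma zmode0r n u : zmode n u 0 = 0.
Proof. by have := zmodeZr n 0 u 0; rewrite !scale0r. Qed.

Lemma zmode_trunc u v : exists N : nat, forall n, n <= - N%:Z -> zmode n u v = 0.
Proof.
elim/hom_ind: u => [|x y [N HN] [M HM]|m x mx].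
- by exists 0%N => n _; rewrite zmode0l.
- by exists (N + M)%N => n Hn; rewrite zmodeDl HN ?HM ?addr0 //; lia.
have [N HN] := vop_trunc_nat x v; exists N => n Hn.
by rewrite (zmode_hom _ _ mx); apply: nsum_eq0 => k; rewrite HN ?scaler0 //; lia.
Qed.

Lemma zmode1_vacl v : zmode 1 vacuum v = v.
Proof.
rewrite (zmode_hom _ _ vacuum_wt) /hmode (@nsum1 _ 0%N) => [|k k0].
  by rewrite zbinom0 scale1r vop_vacuum.
by rewrite (@zbinom_small _ (charC0 R) 0) ?scale0r ?lt0n.
Qed.

Lemma zmode1_vacr u : zmode 1 u vacuum = u.
Proof.
elim/hom_ind: u => [|x y Px Py|m x mx]; first by rewrite zmode0l.
  by rewrite zmodeDl Px Py.
rewrite (zmode_hom _ _ mx) /hmode (@nsum1 _ 0%N) => [|k k0].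
  by rewrite zbinom0 scale1r vop_creation.
by rewrite vop_creation_reg ?scaler0 //; lia.
Qed.

(** Integration by parts: with F(y) = Y((1 + y)^L(0) u, y), inserting L(-1) u + L(0) u gives (1 + y)
    F'(y), and Res y^(-n) (1 + y) F' = n Res y^(-n-1) F + (n - 1) Res y^(-n) F. *)
Lemma zmode_derivative n u v :
  zmode n (Lop (-1) u + Lop 0 u) v =
  n%:~R *: zmode (n + 1) u v + (n - 1)%:~R *: zmode n u v.
Proof.
elim/hom_ind: u => [|x y Px Py|m x mx].
- by rewrite !Lop0r !zmode0l !addr0 zmode0l !scaler0 addr0.
- rewrite !LopD (addrACA (Lop (-1) x)) (zmodeDl n (_ + _ x)) Px Py.
  by rewrite !zmodeDl !scalerDr addrACA.
have mL := Lop_wt (-1) mx.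
rewrite zmodeDl (Lop0_wt mx) zmodeZl !(zmode_hom _ _ mx) (zmode_hom _ _ mL).
rewrite opprK /hmode -!nsumZ; [|exact: fin1_hmode..].
(* The term k + 1 of these two sums carries the same mode of x as the term k of the other two, since
   L(-1) lowers the index by one. *)
rewrite (@nsum_recl _ (fun k => n%:~R *: _)); last exact/fin1Z/fin1_hmode.
rewrite (@nsum_recl _ (fun k => C (m + 1) k *: _)); last exact: fin1_hmode.
have f1 (a : nat -> K) : fin1 (fun k => a k *: vop x (k%:Z - n) v).
  by apply: fin1Z; exact: fin1_vop.
have f2 (a : nat -> K) : fin1 (fun k => a k *: (C m k *: vop x (k%:Z - n) v)).
  by apply: fin1Z; apply: f1.
have f3 (a : nat -> K) : fin1 (fun k : nat => a k *: vop x (k.+1%:Z - (n + 1)) v).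
  apply: fin1Z; have [N HN] := fin1_vop x v (- n); exists N => k Hk.
  by rewrite -(HN k Hk); congr vop; lia.
have f4 (a b : nat -> K) : fin1 (fun k : nat => a k *: (b k *: vop x (k.+1%:Z - (n + 1)) v)).
  by apply: fin1Z; exact: f3.
have f5 (a : nat -> K) : fin1 (fun k : nat => a k *: vop (Lop (-1) x) (k.+1%:Z - n) v).
  apply: fin1Z; have [N HN] := fin1_vop (Lop (-1) x) v (1 - n); exists N => k Hk.
  by rewrite -(HN k Hk); congr vop; lia.
rewrite -!addrA; congr (_ + _).
  rewrite !zbinom0 !scale1r vop_Lm1 -rmorphN /=; congr (_%:~R *: vop _ _ _); lia.
rewrite -!nsumD //; apply: eq_nsum => k.
rewrite vop_Lm1 !scalerA.
have -> : (k.+1%:Z - (n + 1)) = k%:Z - n by lia.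
have -> : (k.+1%:Z - n - 1) = k%:Z - n by lia.
rewrite -!scalerDl; congr (_ *: _).
have E := zbinomSl (charC0 R) (m + 1) k; rewrite addrK in E.
transitivity (n%:~R * C (m + 1) k.+1 - C (m + 1) k.+1 * k.+1%:R + m%:~R * C m k).
  rewrite rmorphB /= -[k.+1%:~R]/(k.+1%:R); ring.
rewrite E zbinom_pascal ?rmorphD ?rmorphB /=; last exact: charC0.
by ring.
Qed.

Lemma fin3_vop_l (m : int) u v w :
  fin3 (fun p t i : nat => vop u (p%:Z - 1 - i%:Z) (vop v (t%:Z - m + i%:Z) w)).
Proof.
apply: fin3_intro.
  have [N HN] := vop_trunc_nat v w; exists (N + `|m|)%N => i j k H.
  by rewrite HN ?vop0r //; lia.
move=> t i; have [N HN] := vop_trunc_nat u (vop v (t%:Z - m + i%:Z) w).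
by exists (N + i + 1)%N => p Hp; rewrite HN //; lia.
Qed.

Lemma fin3_vop_r (m : int) u v w :
  fin3 (fun p t i : nat => vop v (t%:Z - m - 1 - i%:Z) (vop u (p%:Z + i%:Z) w)).
Proof.
suff H : fin3 (fun t p i : nat => vop v (t%:Z - m - 1 - i%:Z) (vop u (p%:Z + i%:Z) w)).
  by have [N HN] := H; exists N => i j k Hijk; apply: HN; lia.
apply: fin3_intro.
  have [N HN] := vop_trunc_nat u w; exists N => i j k H.
  by rewrite HN ?vop0r //; lia.
move=> p i; have [N HN] := vop_trunc_nat v (vop u (p%:Z + i%:Z) w).
by exists (N + i + 1 + `|m|)%N => t Ht; rewrite HN //; lia.
Qed.

Lemma fin1_zmode_l m u v w : fin1 (fun k : nat => zmode (1 + k%:Z) u (zmode (m - k%:Z) v w)).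
Proof.
have [N HN] := zmode_trunc v w; exists (N + `|m|)%N => k Hk.
by rewrite HN ?zmode0r //; lia.
Qed.

Lemma fin1_zmode_r m u v w :
  fin1 (fun k : nat => zmode (m + 1 + k%:Z) v (zmode (- k%:Z) u w)).
Proof.
have [N HN] := zmode_trunc u w; exists N => k Hk.
by rewrite HN ?zmode0r //; lia.
Qed.

Lemma vandermonde_split a b (i s : nat) :
  \sum_(p < s.+1) C a (i + p) * C (i + p)%N i * C b (s - p)%N = C a i * C (a + b - i%:Z) s.
Proof.
have -> : a + b - i%:Z = (a - i%:Z) + b by lia.
rewrite -zbinom_vandermonde ?mulr_sumr; last exact: charC0.
by apply: eq_bigr => p _; rewrite zbinom_trinomial ?mulrA //; exact: charC0.
Qed.

Lemma hmode_nested a b m u v w : wt_space a u -> wt_space b v ->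
  zmode m (zmode 1 u v) w =
  nsum (fun i => nsum (fun r =>
    (C a i * C (a + b - i%:Z) r) *: vop (vop u (i%:Z - 1) v) (r%:Z - m) w)).
Proof.
move=> au bv; rewrite (zmode_hom _ _ au).
rewrite (@nsum_morph _ _ (zmode m ^~ w)) ?zmode0l //; last 2 first.
- by move=> x y; rewrite zmodeDl.
- exact: fin1_hmode.
apply: eq_nsum => i /=; rewrite zmodeZl.
have Hw := vop_wt (i%:Z - 1) au bv.
rewrite (zmode_hom _ _ Hw) -nsumZ; last exact: fin1_hmode.
by apply: eq_nsum => r; rewrite scalerA; congr ((_ * C _ _) *: _); lia.
Qed.

(** The power (1 + y)^(a+b-i) is split as (1 + y)^(a-i) (1 + y)^b and the first factor is absorbed
    by the trinomial identity, so that for fixed p and t the sum over i becomes the left side of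
    [vop_associator]. *)
Lemma nsum_vandermonde a b m u v w :
  nsum (fun i => nsum (fun r =>
    (C a i * C (a + b - i%:Z) r) *: vop (vop u (i%:Z - 1) v) (r%:Z - m) w)) =
  nsum (fun p => nsum (fun t => (C a p * C b t) *:
    nsum (fun i => C p i *: vop (vop u (i%:Z - 1) v) (p%:Z + (t%:Z - m) - i%:Z) w))).
Proof.
pose X i r := vop (vop u (i%:Z - 1) v) (r%:Z - m) w.
have X2 : fin2 X.
  apply: fin2_intro; last by move=> i; exact: fin1_vop.
  have [N HN] := vop_trunc_nat u v; exists N.+1 => i j Hi.
  by rewrite /X HN ?vop0l //; lia.
pose F i p t := (C a (i + p) * C (i + p)%N i * C b t) *: X i (p + t)%N.
have F3 : fin3 F.
  have [N HN] := X2; apply: fin3Z; exists N => i p t H; apply: HN; lia.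
transitivity (nsum (fun i => nsum (fun p => nsum (F i p)))).
  apply: eq_nsum => i; rewrite nsum_diag; last exact: fin3_l.
  apply: eq_nsum => s; rewrite -vandermonde_split scaler_suml.
  apply: eq_bigr => p _; rewrite /F; congr (_ *: X _ _).
  by have := ltn_ord p; lia.
rewrite nsum_diag; last exact: fin3_nsum.
apply: eq_nsum => p; rewrite nsum_sum; last first.
  by move=> i; exact: (fin2_l (fin3_l F3 i)).
apply: eq_nsum => t; rewrite (@nsumE _ p.+1); last first.
  by move=> i Hi; rewrite zbinom_small ?scale0r //; exact: charC0.
rewrite scaler_sumr; apply: eq_bigr => i _; rewrite scalerA /F.
have ip : (i <= p)%N by have := ltn_ord i; lia.
rewrite subnKC //; congr (_ *: vop _ _ _); last by lia.
by rewrite mulrAC.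
Qed.

(* The Jacobi identity with l = -1, for Y((1 + y)^L(0) u, y) v. *)
Lemma zmode_associator m u v w :
  zmode m (zmode 1 u v) w =
  nsum (fun k => zmode (1 + k%:Z) u (zmode (m - k%:Z) v w))
  + nsum (fun k => zmode (m + 1 + k%:Z) v (zmode (- k%:Z) u w)).
Proof.
elim/hom_ind: u => [|x y Px Py|a u au].
- rewrite !zmode0l !nsum_eq0 ?addr0 // => k; last by rewrite zmode0l.
  by rewrite zmode0l zmode0r.
- rewrite !zmodeDl Px Py addrACA; congr (_ + _).
    rewrite -nsumD; [|exact: fin1_zmode_l..].
    by apply: eq_nsum => k; rewrite ?zmodeDl ?zmodeDr.
  rewrite -nsumD; [|exact: fin1_zmode_r..].
  by apply: eq_nsum => k; rewrite ?zmodeDl ?zmodeDr.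
elim/hom_ind: v => [|x y Px Py|b v bv].
- rewrite zmode0r zmode0l !nsum_eq0 ?addr0 // => k; first by rewrite zmode0l.
  by rewrite zmode0l zmode0r.
- rewrite zmodeDr !zmodeDl Px Py addrACA; congr (_ + _).
    rewrite -nsumD; [|exact: fin1_zmode_l..].
    by apply: eq_nsum => k; rewrite ?zmodeDl ?zmodeDr.
  rewrite -nsumD; [|exact: fin1_zmode_r..].
  by apply: eq_nsum => k; rewrite ?zmodeDl ?zmodeDr.
rewrite (hmode_nested _ _ au bv) nsum_vandermonde.
pose A p t i := (C a p * C b t) *: vop u (p%:Z - 1 - i%:Z) (vop v (t%:Z - m + i%:Z) w).
pose B p t i := (C a p * C b t) *: vop v (t%:Z - m - 1 - i%:Z) (vop u (p%:Z + i%:Z) w).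
have A3 : fin3 A by apply: fin3Z; exact: fin3_vop_l.
have B3 : fin3 B by apply: fin3Z; exact: fin3_vop_r.
transitivity (nsum (fun p => nsum (fun t => nsum (A p t)))
              + nsum (fun p => nsum (fun t => nsum (B p t)))).
  rewrite -nsumD; [|exact: fin2_nsum (fin3_nsum A3)|exact: fin2_nsum (fin3_nsum B3)].
  apply: eq_nsum => p; rewrite -nsumD; [|exact: fin2_l (fin3_nsum A3) p|exact: fin2_l (fin3_nsum B3) p].
  apply: eq_nsum => t; rewrite vop_associator.
  rewrite -nsumD; [|exact: fin2_l (fin3_l A3 p) t|exact: fin2_l (fin3_l B3 p) t].
  rewrite -nsumZ; last first.
    apply: fin1D.
      exact: (fin2_l (fin3_l (fin3_vop_l m u v w) p) t).
    exact: (fin2_l (fin3_l (fin3_vop_r m u v w) p) t).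
  by apply: eq_nsum => i; rewrite scalerDr.
(* The index i of the Jacobi identity becomes outermost; for fixed i = k the sums over p and t
   recombine into two nested modes. *)
rewrite (nsum3_rot A3) (nsum3_rot B3); congr (_ + _); apply: eq_nsum => k.
- rewrite (zmode_hom _ _ au) (zmode_hom _ _ bv); apply: eq_nsum => p.
  rewrite (@nsum_morph _ _ (vop u (p%:Z - (1 + k%:Z)))) ?vop0r //; last 2 first.
  + by move=> x y; rewrite vopDr.
  + exact: fin1_hmode.
  rewrite -nsumZ; last by apply: fin1_morph; rewrite ?vop0r //; exact: fin1_hmode.
  apply: eq_nsum => t /=; rewrite vopZr scalerA /A; congr (_ *: vop _ _ (vop _ _ _)); lia.
- rewrite (zmode_hom _ _ au) (zmode_hom _ _ bv) nsum_exchange; last first.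
    exact: fin3_l (fin3_rot B3) k.
  apply: eq_nsum => t.
  rewrite (@nsum_morph _ _ (vop v (t%:Z - (m + 1 + k%:Z)))) ?vop0r //; last 2 first.
  + by move=> x y; rewrite vopDr.
  + exact: fin1_hmode.
  rewrite -nsumZ; last by apply: fin1_morph; rewrite ?vop0r //; exact: fin1_hmode.
  apply: eq_nsum => p /=; rewrite vopZr scalerA /B mulrC; congr (_ *: vop _ _ (vop _ _ _)); lia.
Qed.

End ZhuModes.

(** * Linear spans *)

Section LinearSpan.
Variables (K : pzRingType) (V : lmodType K) (S : set V).

Lemma lspan_sub v : S v -> lspan S v.
Proof.
move=> Sv; exists 1%N, (fun=> 1), (fun=> v); split=> //.
by rewrite big_ord1 scale1r.
Qed.

Lemma lspan0 : lspan S 0.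
Proof. by exists 0%N, (fun=> 0), (fun=> 0); split=> [[]|]; rewrite ?big_ord0. Qed.

Lemma lspanD u v : lspan S u -> lspan S v -> lspan S (u + v).
Proof.
move=> [m [a [s [Ss ->]]]] [n [b [t [St ->]]]].
exists (m + n)%N, (fun i => match fintype.split i with inl j => a j | inr j => b j end).
exists (fun i => match fintype.split i with inl j => s j | inr j => t j end); split.
  by move=> i; case: fintype.split.
rewrite big_split_ord; congr (_ + _); apply: eq_bigr => i _.
  by rewrite -[lshift n i]/(unsplit (inl i)) unsplitK.
by rewrite -[rshift m i]/(unsplit (inr i)) unsplitK.
Qed.

Lemma lspanZ c v : lspan S v -> lspan S (c *: v).
Proof.
move=> [m [a [s [Ss ->]]]]; exists m, (fun i => c * a i), s; split=> //.
by rewrite scaler_sumr; apply: eq_bigr => i _; rewrite scalerA.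
Qed.

Lemma lspanN v : lspan S v -> lspan S (- v).
Proof. by rewrite -scaleN1r; exact: lspanZ. Qed.

Lemma lspan_sum n (F : 'I_n -> V) : (forall i, lspan S (F i)) -> lspan S (\sum_(i < n) F i).
Proof. by move=> SF; elim/big_ind: _ => //; [exact: lspan0|exact: lspanD]. Qed.

Lemma lspan_nsum F : fin1 F -> (forall i, lspan S (F i)) -> lspan S (nsum F).
Proof. by move=> [N FN] SF; rewrite (nsumE FN); exact: lspan_sum. Qed.

Lemma lspan_ind (P : V -> Prop) : P 0 -> (forall x y, P x -> P y -> P (x + y)) ->
  (forall c x, P x -> P (c *: x)) -> (forall x, S x -> P x) ->
  forall v, lspan S v -> P v.
Proof.
move=> P0 PD PZ PS v [m [a [s [Ss ->]]]].
by elim/big_ind: _ => // i _; exact/PZ/PS.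
Qed.

End LinearSpan.

(** * The two-sided ideal O(V) *)

Section ZhuIdeal.
Variables (R : realType) (V : voaType R).
Local Notation K := (R[i]).
Local Notation O := (@zhu_O R V).
Implicit Types u v w x : V.

Lemma zmode2_derivative u v : zmode 2 u v = zmode 1 (Lop (-1) u + Lop 0 u) v.
Proof. by rewrite zmode_derivative subrr scale0r addr0 scale1r. Qed.

(** [zmode_derivative] at order n + 2 has the invertible coefficient n + 2 in front of the mode of
    order n + 3, so all higher residues reduce to order 2. *)
Lemma zhu_O_zmode (n : nat) u v : (1 < n)%N -> O (zmode n u v).
Proof.
case: n => [|[|n]] // _; elim: n u v => [|n IHn] u v.
  by apply: lspan_sub; exists u, v.
have n0 : n.+2%:R != 0 :> K by move/pcharf0P: (charC0 R) => ->.
have /eqP := zmode_derivative n.+2 u v; rewrite -subr_eq.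
move=> /eqP/(congr1 ( *:%R n.+2%:R^-1)).
rewrite scalerA mulVf // scale1r (_ : n.+2%:Z + 1 = n.+3); last lia.
by move=> <-; apply/lspanZ/lspanD; [exact: IHn|apply/lspanN/lspanZ; exact: IHn].
Qed.

Lemma zhu_O_zmode_tail (m : int) (n : nat) u v w : (1 < n)%N ->
  O (nsum (fun k => zmode (n + k)%N u (zmode (m - k%:Z) v w))).
Proof.
move=> n1; apply: lspan_nsum; last by move=> k; apply: zhu_O_zmode; lia.
have [N HN] := zmode_trunc v w; exists (N + `|m|)%N => k Hk.
by rewrite HN ?zmode0r //; lia.
Qed.

(* For m = 1 this is associativity modulo O; for m = 2 it shows that O is stable
   under left multiplication. *)
Lemma zhu_O_associator (m : nat) u v w : (0 < m)%N ->
  O (zmode m (zmode 1 u v) w - zmode 1 u (zmode m v w)).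
Proof.
move=> m0; rewrite zmode_associator nsum_recl; last exact: fin1_zmode_l.
have E0 : zmode (1 + 0%:Z) u (zmode (m%:Z - 0%:Z) v w) = zmode 1 u (zmode m v w).
  have -> : 1 + 0%:Z = 1 by lia.
  have -> : m%:Z - 0%:Z = m%:Z by lia.
  by [].
have addKAC (a b c : V) : a + b + c - a = b + c by rewrite addrAC [a + b]addrC addrK.
rewrite E0 addKAC.
(* The term k = 0 has cancelled; the remaining outer modes have orders 1 + k with k > 0 and m + 1 +
   k, all at least 2 because m > 0. *)
apply: lspanD.
  rewrite (eq_nsum (G := fun k => zmode (2 + k)%N u (zmode (m%:Z - 1 - k%:Z) v w))).
    exact: zhu_O_zmode_tail.
  move=> k; have -> : 1 + k.+1%:Z = (2 + k)%N by lia.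
  by have -> : m%:Z - k.+1%:Z = m%:Z - 1 - k%:Z by lia.
rewrite (eq_nsum (G := fun k => zmode (m.+1 + k)%N v (zmode (0 - k%:Z) u w))).
  exact: zhu_O_zmode_tail.
move=> k; have -> : m%:Z + 1 + k%:Z = (m.+1 + k)%N by lia.
by rewrite sub0r.
Qed.

Lemma zhu_O_mulr u x : O x -> O (zmode 1 u x).
Proof.
elim/lspan_ind => [|y z Oy Oz|c y Oy|_ [v [w ->]]].
- by rewrite zmode0r; exact: lspan0.
- by rewrite zmodeDr; exact: lspanD.
- by rewrite zmodeZr; exact: lspanZ.
rewrite zhu_resE -[zmode 1 u _](subKr (zmode 2%N (zmode 1 u v) w)).
by apply/lspanD; [exact: zhu_O_zmode|apply/lspanN/zhu_O_associator].
Qed.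

(** A generator is itself a product: [zmode 2 u v] is [zmode 1 u' v] with u' = L(-1) u + L(0) u.
    Associativity modulo O moves w into the right factor, and the result is again a residue of order
    2. *)
Lemma zhu_O_mull w x : O x -> O (zmode 1 x w).
Proof.
elim/lspan_ind => [|y z Oy Oz|c y Oy|_ [u [v ->]]].
- by rewrite zmode0l; exact: lspan0.
- by rewrite zmodeDl; exact: lspanD.
- by rewrite zmodeZl; exact: lspanZ.
rewrite zhu_resE zmode2_derivative; set u' := _ + _.
rewrite -[zmode 1 _ w](subrK (zmode 1 u' (zmode 1%N v w))).
apply/lspanD; first exact: zhu_O_associator.
by rewrite -zmode2_derivative; exact: zhu_O_zmode.
Qed.

End ZhuIdeal.

(** * The change of coordinate *)

Section EulerOperator.
Variables (R : realType) (V : voaType R).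
Local Notation K := (R[i]).
Local Notation C := (zbinom K).
Implicit Types u v w z : V.

(* (1 + y) log (1 + y) = sum_j (log_coef j) y^(j+1) *)
Definition log_coef (j : nat) : K :=
  if j is 0%N then 1 else (-1) ^+ j.+1 / (j * j.+1)%:R.

Lemma natS_neq0 n : n.+1%:R != 0 :> K.
Proof. by move/pcharf0P: (charC0 R) => ->. Qed.

Lemma log_coefS j : log_coef j.+1 = (-1) ^+ j / (j.+1%:R * j.+2%:R).
Proof. by rewrite /log_coef natrM !exprS !mulN1r opprK. Qed.

(** The coefficient of y^(j+1) in (1 + y) l'(y) = (1 + y) + l(y), for l(y) = (1 + y) log (1 + y). *)
Lemma log_coef_rec j :
  j.+2%:R * log_coef j.+1 + j%:R * log_coef j = (j == 0)%:R.
Proof.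
case: j => [|j].
  by rewrite mul0r addr0 log_coefS expr0 !mul1r divff // natS_neq0.
rewrite !log_coefS exprS; have := natS_neq0 j.+1; have := natS_neq0 j; have := natS_neq0 j.+2.
move: (j.+1%:R : K) (j.+2%:R : K) (j.+3%:R : K) => x y t t0 x0 y0 /=.
by field; rewrite t0 x0 y0.
Qed.

(** For k >= 2 the k-th derivative of l(y) = (1 + y) log (1 + y) is a multiple of (1 + y)^(1-k).
    This compares the coefficients of y^r for k = i + 2, after division by k!. *)
Lemma log_coef_binomial i r :
  log_coef (i.+1 + r) * C (i.+1 + r + 1)%N i.+2 = log_coef i.+1 * C (- i.+1%:Z) r.
Proof.
rewrite addSn !log_coefS zbinom_negS ?zbinom_nat; try exact: charC0.
have E : (i.+2 * i.+1 * 'C((i + r).+2, i.+2) = (i + r).+2 * (i + r).+1 * 'C(i + r, r))%N.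
  rewrite mulnAC -mul_bin_diag mulnAC -mulnA -mul_bin_diag.
  by rewrite -(@bin_sub _ r) ?leq_addl // addnK mulnA.
have := congr1 (fun n => n%:R : K) E; rewrite addn1 !natrM => {}E.
have [a0 b0 c0 d0] : [/\ i.+1%:R != 0 :> K, i.+2%:R != 0 :> K,
  (i + r).+1%:R != 0 :> K & (i + r).+2%:R != 0 :> K] by split; exact: natS_neq0.
move: E a0 b0 c0 d0; rewrite exprD.
move: (i.+1%:R : K) (i.+2%:R : K) ((i + r).+1%:R : K) ((i + r).+2%:R : K)
  ('C(_, _)%:R : K) ('C(_, _)%:R : K) => a b c d x y E a0 b0 c0 d0.
have -> : y = d * c * x / (b * a) by rewrite -E; field; rewrite a0 b0.
by field; rewrite a0 b0 c0 d0.
Qed.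

Lemma log_coef_sum_ge2 (a : int) (i s : nat) :
  \sum_(r < s.+1) log_coef (i.+1 + r) * C (i.+1 + r + 1)%N i.+2 * C a (s - r)%N =
  log_coef i.+1 * C (a - i.+1%:Z) s.
Proof.
have -> : a - i.+1%:Z = - i.+1%:Z + a by rewrite addrC.
rewrite -(zbinom_vandermonde (charC0 R)) mulr_sumr.
by apply: eq_bigr => r _; rewrite log_coef_binomial -mulrA.
Qed.

(** The coefficient of y^s in a l'(y) (1 + y)^a - l(y) ((1 + y)^a)' = a (1 + y)^a, which holds
    because l' = 1 + log (1 + y). *)
Lemma log_coef_sum_le1 (a : int) (s : nat) :
  \sum_(j < s.+1) log_coef j * C a (s - j)%N * (a * j.+1%:Z - (s - j)%:Z)%:~R =
  a%:~R * C a s.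
Proof.
case: s => [|s]; first by rewrite big_ord1 subn0 mulr1 subr0 mul1r mulrC.
(* In terms of the coefficients of (1 + y)^(a-1), neighbouring c_j combine as in [log_coef_rec]. *)
pose D := C (a - 1).
have CS t : C a t.+1 = D t.+1 + D t.
  by rewrite -zbinom_pascal ?subrK //; exact: charC0.
rewrite [in RHS]CS mulrDr big_ord_recr /= subnn subr0.
rewrite (eq_bigr (fun j : 'I_s.+1 => a%:~R * (log_coef j * j.+1%:R * D (s - j).+1
    + log_coef j * j%:R * D (s - j)%N))); last first.
  move=> j _; have js : (j <= s)%N by rewrite -ltnS.
  rewrite subSn // rmorphB rmorphM /= mulrBr -[(s - j).+1%:~R]/((s - j).+1%:R).
  rewrite -[X in _ - X]mulrA zbinomSl; last exact: charC0.
  by rewrite CS -/D -[j.+1%:~R]/(j.+1%:R) -natr1; ring.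
rewrite -mulr_sumr big_split /= zbinom0 mulr1 rmorphM /= mulrCA.
rewrite -!mulrDr; congr (_ * _).
have -> : \sum_(j < s.+1) log_coef j * j.+1%:R * D (s - j).+1
     + \sum_(j < s.+1) log_coef j * j%:R * D (s - j)%N + log_coef s.+1 * s.+2%:~R
   = \sum_(j < s.+2) log_coef j * j.+1%:R * D (s.+1 - j)%N
     + \sum_(j < s.+1) log_coef j * j%:R * D (s - j)%N.
  rewrite addrAC; congr (_ + _); rewrite [RHS]big_ord_recr /= subnn /D zbinom0 mulr1.
  by congr (_ + _); apply: eq_bigr => j _; rewrite subSn // -ltnS.
rewrite big_ord_recl /= subn0 !mul1r -addrA; congr (_ + _).
rewrite -big_split /= big_ord_recl /= big1 ?addr0 => [|j _].
  have E : log_coef 1 * 2%:R = 1 by have := log_coef_rec 0; rewrite mul0r addr0 mulrC.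
  by rewrite /bump /= E subSS subn0 mul1r mulr0 mul0r addr0.
have := log_coef_rec (bump 0 j); rewrite /bump /= !add1n => E.
by rewrite subSS -mulrDl [_ * j.+3%:R]mulrC [_ * j.+1%:R]mulrC E mul0r.
Qed.

(* The vector field (1 + y) log (1 + y) d/dy, that is x d/dx. *)
Definition Eop v : V := nsum (fun j => log_coef j *: Lop j v).

Lemma fin1_Lop (a : nat -> K) v : fin1 (fun j : nat => a j *: Lop j v).
Proof.
apply: fin1Z; have [N HN] := Lop_trunc v; exists N => j Hj; exact: HN.
Qed.

Lemma EopD u v : Eop (u + v) = Eop u + Eop v.
Proof.
by rewrite /Eop -nsumD; [apply: eq_nsum => j; rewrite LopD scalerDr|exact: fin1_Lop..].
Qed.

Lemma EopZ a v : Eop (a *: v) = a *: Eop v.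
Proof.
rewrite /Eop -nsumZ; last exact: fin1_Lop.
by apply: eq_nsum => j; rewrite LopZ !scalerA mulrC.
Qed.

Lemma Eop0 : Eop 0 = 0.
Proof. by apply: nsum_eq0 => j; rewrite Lop0r scaler0. Qed.

Lemma fin3_commutator n w z : fin3 (fun i j k : nat =>
  vop (Lop (i%:Z - 1) w) (j%:Z + 1 + (k%:Z - n) - i%:Z) z).
Proof.
apply: fin3_intro_l.
  have [N HN] := Lop_trunc w; exists N.+1 => i j k Hi.
  by rewrite HN ?vop0l //; lia.
move=> i; have [N HN] := vop_trunc_nat (Lop (i%:Z - 1) w) z.
by exists (N + `|n| + i)%N => j k H; apply: HN; lia.
Qed.

(** In generating functions, [E, Y(w, y)] is the sum over i of (l^(i)(y) / i!) Y(L(i-1) w, y).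
    Summing over i outermost isolates one derivative of l at a time. *)
Lemma Eop_hmode_commutator a n w z :
  Eop (hmode a n w z) - hmode a n w (Eop z) =
  nsum (fun i => nsum (fun j => nsum (fun k =>
    (log_coef j * C a k * C (j%:Z + 1) i) *:
      vop (Lop (i%:Z - 1) w) (j%:Z + 1 + (k%:Z - n) - i%:Z) z))).
Proof.
pose X (j k : nat) := Lop j (vop w (k%:Z - n) z).
pose Y (j k : nat) := vop w (k%:Z - n) (Lop j z).
have X2 : fin2 X.
  apply: fin2_sym; apply: fin2_intro.
    have [N HN] := fin1_vop w z (- n); exists N => k j Hk.
    by rewrite /X HN ?Lop0r.
  by move=> k; have [N HN] := Lop_trunc (vop w (k%:Z - n) z); exists N => j Hj; exact: HN.
have Y2 : fin2 Y.
  apply: fin2_intro; last by move=> j; exact: fin1_vop.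
  have [N HN] := Lop_trunc z; exists N => j k Hj.
  by rewrite /Y HN ?vop0r.
pose F j k i := (log_coef j * C a k * C (j%:Z + 1) i) *:
      vop (Lop (i%:Z - 1) w) (j%:Z + 1 + (k%:Z - n) - i%:Z) z.
have F3 : fin3 F by apply: fin3Z; exact: fin3_rot (fin3_rot (fin3_commutator n w z)).
rewrite -(nsum3_rot F3).
have -> : Eop (hmode a n w z) = nsum (fun j => nsum (fun k => (log_coef j * C a k) *: X j k)).
  apply: eq_nsum => j; rewrite /hmode (@nsum_morph _ _ (Lop j)) ?Lop0r //; last 2 first.
  - by move=> x y; rewrite LopD.
  - exact: fin1_hmode.
  rewrite -nsumZ; last by apply: fin1_morph; rewrite ?Lop0r //; exact: fin1_hmode.
  by apply: eq_nsum => k /=; rewrite LopZ scalerA.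
have -> : hmode a n w (Eop z) = nsum (fun j => nsum (fun k => (log_coef j * C a k) *: Y j k)).
  rewrite nsum_exchange; last exact: fin2Z.
  apply: eq_nsum => k; rewrite (@nsum_morph _ _ (vop w (k%:Z - n))) ?vop0r //; last 2 first.
  - by move=> x y; rewrite vopDr.
  - exact: fin1_Lop.
  rewrite -nsumZ; last by apply: fin1_morph; rewrite ?vop0r //; exact: fin1_Lop.
  by apply: eq_nsum => j /=; rewrite vopZr scalerA mulrC.
rewrite -nsumB; [|exact/fin2_nsum/fin2Z..].
apply: eq_nsum => j; rewrite -nsumB; [|exact/fin1Z/fin2_l..].
apply: eq_nsum => k; rewrite -scalerBr Lop_commutator.
rewrite -nsumZ; last first.
  apply: fin1Z; exact: (fin2_l (fin3_l (fin3_rot (fin3_rot (fin3_commutator n w z))) j) k).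
by apply: eq_nsum => i; rewrite scalerA.
Qed.

(** The derivative of l of order i + 2, divided by (i + 2)!, is c_(i+1) (1 + y)^(-i-1). If w has
    weight a, the exponent a - i - 1 is the weight of L(i+1) w, so the term is a mode of Y((1 +
    y)^L(0) L(i+1) w, y). *)
Lemma commutator_term_ge2 a n w z i :
  nsum (fun j => nsum (fun k => (log_coef j * C a k * C (j%:Z + 1) i.+2) *:
      vop (Lop (i.+2%:Z - 1) w) (j%:Z + 1 + (k%:Z - n) - i.+2%:Z) z)) =
  log_coef i.+1 *: hmode (a - i.+1%:Z) n (Lop i.+1 w) z.
Proof.
have -> : i.+2%:Z - 1 = i.+1%:Z by lia.
pose Y s := vop (Lop i.+1 w) (s%:Z - n) z.
have Y1 : fin1 Y by exact: fin1_vop.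
(* The binomial coefficient of j + 1 over i + 2 vanishes for j < i + 1. *)
rewrite (nsum_shift (p := i.+1)); last 2 first.
- move=> j ji; apply: nsum_eq0 => k.
  rewrite (_ : j%:Z + 1 = j.+1%:Z); last lia.
  by rewrite zbinom_small ?mulr0 ?scale0r //; exact: charC0.
- have := fin3_l (fin3_commutator n w z) i.+2; rewrite (_ : i.+2%:Z - 1 = i.+1%:Z); last lia.
  by move=> F2; apply/fin2_nsum/fin2Z.
pose F r k := (log_coef (i.+1 + r) * C (i.+1 + r + 1)%N i.+2 * C a k) *: Y (r + k)%N.
have F2 : fin2 F by have [N HN] := Y1; apply: fin2Z; exists N => r k H; exact: HN.
transitivity (nsum (fun r => nsum (F r))).
  apply: eq_nsum => r; apply: eq_nsum => k; rewrite /F /Y mulrAC.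
  by congr (_ *: vop _ _ _); lia.
rewrite nsum_diag // -nsumZ; last exact: fin1_hmode.
apply: eq_nsum => s; rewrite scalerA -log_coef_sum_ge2 scaler_suml.
by apply: eq_bigr => r _; rewrite /F subnKC // -ltnS.
Qed.

(** With Y = Y(w, y) and F = (1 + y)^a Y, the orders 0 and 1 contribute (1 + y)^a (l Y' + a l' Y) =
    l F' + a F; integrating l F' by parts produces the factors j + 1 - n. *)
Lemma commutator_terms_le1 a n w z : wt_space a w ->
  nsum (fun j => nsum (fun k => (log_coef j * C a k * C (j%:Z + 1) 0) *:
      vop (Lop (0%:Z - 1) w) (j%:Z + 1 + (k%:Z - n) - 0%:Z) z)) +
  nsum (fun j => nsum (fun k => (log_coef j * C a k * C (j%:Z + 1) 1) *:
      vop (Lop (1%:Z - 1) w) (j%:Z + 1 + (k%:Z - n) - 1%:Z) z)) =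
  log_coef 0 *: hmode a n (Lop 0 w) z -
  nsum (fun j => (log_coef j * (j.+1%:Z - n)%:~R) *: hmode a (n - j%:Z) w z).
Proof.
move=> aw; pose Y s := vop w (s%:Z - n) z.
have Y1 : fin1 Y by exact: fin1_vop.
have Y2 (f : nat -> nat -> K) : fin2 (fun j k => f j k *: Y (j + k)%N).
  by have [N HN] := Y1; apply: fin2Z; exists N => r k H; exact: HN.
have Y3 j (f : nat -> K) : fin1 (fun k => f k *: Y (j + k)%N).
  by apply: fin1Z; exact: fin1_shift.
have -> : nsum (fun j => nsum (fun k => (log_coef j * C a k * C (j%:Z + 1) 0) *:
      vop (Lop (0%:Z - 1) w) (j%:Z + 1 + (k%:Z - n) - 0%:Z) z)) =
  nsum (fun j => nsum (fun k => (log_coef j * C a k * - (j.+1%:Z + (k%:Z - n))%:~R) *: Y (j + k)%N)).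
  apply: eq_nsum => j; apply: eq_nsum => k; rewrite zbinom0 mulr1.
  rewrite (_ : 0%:Z - 1 = -1) // vop_Lm1 scalerA /Y.
  by congr (_ * (- _%:~R) *: vop _ _ _); lia.
have -> : nsum (fun j => nsum (fun k => (log_coef j * C a k * C (j%:Z + 1) 1) *:
      vop (Lop (1%:Z - 1) w) (j%:Z + 1 + (k%:Z - n) - 1%:Z) z)) =
  nsum (fun j => nsum (fun k => (log_coef j * C a k * (a * j.+1%:Z)%:~R) *: Y (j + k)%N)).
  apply: eq_nsum => j; apply: eq_nsum => k; rewrite zbinom1 subrr (Lop0_wt aw) vopZl.
  rewrite scalerA /Y (_ : j%:Z + 1 = j.+1%:Z); last lia.
  rewrite -mulrA -rmorphM /=.
  by congr (_ * _%:~R *: vop _ _ _); lia.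
have -> : nsum (fun j => (log_coef j * (j.+1%:Z - n)%:~R) *: hmode a (n - j%:Z) w z) =
  nsum (fun j => nsum (fun k => (log_coef j * C a k * (j.+1%:Z - n)%:~R) *: Y (j + k)%N)).
  apply: eq_nsum => j; rewrite -nsumZ; last exact: fin1_hmode.
  apply: eq_nsum => k; rewrite scalerA mulrAC /Y; congr (_ *: vop _ _ _); lia.
apply/eqP; rewrite eq_sym subr_eq eq_sym; apply/eqP.
rewrite -nsumD; [|exact/fin2_nsum/Y2..].
rewrite -nsumD; [|exact/fin1D/fin2_nsum/Y2/fin2_nsum/Y2|exact/fin2_nsum/Y2].
transitivity (nsum (fun j => nsum (fun k =>
  (log_coef j * C a k * (a * j.+1%:Z - k%:Z)%:~R) *: Y (j + k)%N))).
  apply: eq_nsum => j; rewrite -nsumD; [|exact: Y3..].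
  rewrite -nsumD; [|apply: fin1D; exact: Y3|exact: Y3].
  apply: eq_nsum => k; rewrite -!scalerDl -!mulrDr -rmorphN -!rmorphD /=.
  by congr ((_ * _%:~R) *: _); lia.
rewrite nsum_diag ?scale1r; last exact: Y2.
apply: eq_nsum => s; rewrite (Lop0_wt aw) vopZl scalerA mulrC -log_coef_sum_le1 scaler_suml.
by apply: eq_bigr => j _; rewrite subnKC // -ltnS.
Qed.

(** E acts on modes as a derivation, up to the vector field l(y) d/dy acting on the variable. The
    orders i >= 2 of the commutator supply the terms c_(i-1) L(i-1) of [Eop w]; the orders 0 and 1
    supply c_0 L(0) and the correction. *)
Lemma Eop_zmode n w z :
  Eop (zmode n w z) = zmode n w (Eop z) + zmode n (Eop w) z
    - nsum (fun j => (log_coef j * (j.+1%:Z - n)%:~R) *: zmode (n - j%:Z) w z).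
Proof.
have f1 (x y : V) : fin1 (fun j : nat => (log_coef j * (j.+1%:Z - n)%:~R) *: zmode (n - j%:Z) x y).
  apply: fin1Z; have [N HN] := zmode_trunc x y; exists (N + `|n|)%N => j Hj.
  by apply: HN; lia.
elim/hom_ind: w => [|x y Px Py|a w aw].
- rewrite Eop0 !zmode0l Eop0 !addr0 nsum_eq0 ?subr0 // => j.
  by rewrite zmode0l scaler0.
- rewrite !zmodeDl !EopD Px Py !zmodeDl.
  rewrite [in RHS](eq_nsum (G := fun j => (log_coef j * (j.+1%:Z - n)%:~R) *: zmode (n - j%:Z) x z +
     (log_coef j * (j.+1%:Z - n)%:~R) *: zmode (n - j%:Z) y z)); last first.
    by move=> j; rewrite zmodeDl scalerDr.
  by rewrite nsumD // opprD addrACA (addrACA (zmode n x _)).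
have F3 := fin3_commutator n w z.
rewrite (zmode_hom _ _ aw) (zmode_hom _ _ aw) -addrA.
rewrite -[LHS](subrK (hmode a n w (Eop z))) addrC; congr (_ + _).
rewrite Eop_hmode_commutator.
have G3 := fin3Z (fun i j k => log_coef j * C a k * C (j%:Z + 1) i) F3.
have G1 := fin2_nsum (fin3_nsum G3).
rewrite (nsum_recl G1) (nsum_recl (fin1_S G1)).
rewrite addrA commutator_terms_le1 // addrAC.
rewrite [in RHS](eq_nsum (G := fun j => (log_coef j * (j.+1%:Z - n)%:~R) *: hmode a (n - j%:Z) w z)); last first.
  by move=> j; rewrite (zmode_hom _ _ aw).
congr (_ - _).
have -> : zmode n (Eop w) z = nsum (fun i => log_coef i *: hmode (a - i%:Z) n (Lop i w) z).
  rewrite (@nsum_morph _ _ (zmode n ^~ z)) ?zmode0l //; last 2 first.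
  - by move=> x y; rewrite zmodeDl.
  - exact: fin1_Lop.
  by apply: eq_nsum => i /=; rewrite zmodeZl (zmode_hom _ _ (Lop_wt i aw)).
rewrite [in RHS]nsum_recl ?subr0; last first.
  have [N HN] := Lop_trunc w; exists N => i Hi; rewrite HN ?hmode0l ?scaler0 //.
congr (_ + _).
by apply: eq_nsum => i; rewrite commutator_term_ge2.
Qed.

End EulerOperator.

(** * The filtration by weight *)

Section WeightFiltration.
Variables (R : realType) (V : voaType R).
Local Notation K := (R[i]).
Implicit Types u v w z : V.

Definition wtle (m : int) v := forall k, m < k -> wt_comp v k = 0.

Lemma wtle0 m : wtle m 0. Proof. by move=> k _; rewrite wt_comp0. Qed.

Lemma wtleD m u v : wtle m u -> wtle m v -> wtle m (u + v).
Proof. by move=> mu mv k mk; rewrite wt_compD mu ?mv ?addr0. Qed.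

Lemma wtleZ m a v : wtle m v -> wtle m (a *: v).
Proof. by move=> mv k mk; rewrite wt_compZ mv ?scaler0. Qed.

Lemma wtleB m u v : wtle m u -> wtle m v -> wtle m (u - v).
Proof. by move=> mu mv; rewrite -scaleN1r; apply/wtleD => //; exact: wtleZ. Qed.

Lemma wtle_nsum m F : fin1 F -> (forall i, wtle m (F i)) -> wtle m (nsum F).
Proof.
move=> [N FN] mF; rewrite (nsumE FN).
by elim/big_ind: _ => //; [exact: wtle0|exact: wtleD].
Qed.

Lemma wtle_weaken m n v : m <= n -> wtle m v -> wtle n v.
Proof. by move=> mn mv k nk; apply: mv; exact: le_lt_trans nk. Qed.

Lemma wtle_hom m v : wt_space m v -> wtle m v.
Proof. by move=> mv k mk; rewrite (wt_comp_hom mv) gt_eqF. Qed.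

Lemma wtle_ind m (P : V -> Prop) : P 0 -> (forall x y, P x -> P y -> P (x + y)) ->
  (forall k x, k <= m -> wt_space k x -> P x) -> forall v, wtle m v -> P v.
Proof.
move=> P0 PD Phom v mv; have [s ->] := wt_comp_seq v.
elim/big_ind: _ => // k _; have [km|mk] := lerP k m; last by rewrite mv.
by apply: Phom km _; have [] := wt_compP v.
Qed.

Lemma wtle_exists v : exists m, wtle m v.
Proof.
elim/hom_ind: v => [|x y [m mx] [n ny]|m x mx].
- by exists 0; exact: wtle0.
- exists (Num.max m n); apply: wtleD; [apply: wtle_weaken mx|apply: wtle_weaken ny];
    by rewrite le_max lexx ?orbT.
- by exists m; exact: wtle_hom.
Qed.

Lemma wtle_bounded : exists N : int, forall v, wtle (N - 1) v -> v = 0.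
Proof.
have [N HN] := @wt_space_bounded R V; exists N => v Nv.
apply: wt_comp_eq0 => n; have [nN|Nn] := ltP n N; last by apply: Nv; lia.
by apply: (HN n nN); have [] := wt_compP v.
Qed.

Lemma wtle_pred p v : wtle p v -> wt_comp v p = 0 -> wtle (p - 1) v.
Proof.
move=> pv v0 k pk; have [->//|kp] := eqVneq k p.
by apply: pv; lia.
Qed.

(** Each vanishing top component lowers the bound on the weights by one, and the weights of V are
    bounded below. *)
Lemma wtle_descent (Q : V -> Prop) :
  (forall p v, Q v -> wtle p v -> wt_comp v p = 0) -> forall v, Q v -> v = 0.
Proof.
move=> H v Qv; have [N HN] := wtle_bounded; have [m mv] := wtle_exists v.
have D k : wtle (m - k%:Z) v.
  elim: k => [|k IHk]; first by rewrite subr0.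
  have := wtle_pred IHk (H _ _ Qv IHk); rewrite (_ : m - k.+1%:Z = m - k%:Z - 1) //.
  by lia.
apply: HN; apply: (@wtle_weaken (m - (absz (m - N + 1))%:Z)); last exact: D.
lia.
Qed.

Lemma wtle_vop a b n u v : wtle a u -> wtle b v -> wtle (a + b - n - 1) (vop u n v).
Proof.
move=> au bv; move: u au; apply: wtle_ind => [|x y Px Py|k u ka ku].
- by rewrite vop0l; exact: wtle0.
- by rewrite vopDl; exact: wtleD.
move: v bv; apply: wtle_ind => [|x y Px Py|l v lb lv].
- by rewrite vop0r; exact: wtle0.
- by rewrite vopDr; exact: wtleD.
by apply: wtle_weaken (wtle_hom (vop_wt n ku lv)); lia.
Qed.

Lemma wtle_Lop p j v : wtle p v -> wtle (p - j) (Lop j v).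
Proof.
move=> pv; have := wtle_vop (n := j + 1) (wtle_hom (@conformal_wt _ V)) pv.
by apply: wtle_weaken; lia.
Qed.

Lemma wtle_zmode a b n u v : wtle a u -> wtle b v -> wtle (a + b + n - 1) (zmode n u v).
Proof.
move=> au bv; move: u au; apply: wtle_ind => [|x y Px Py|k u ka ku].
- by rewrite zmode0l; exact: wtle0.
- by rewrite zmodeDl; exact: wtleD.
rewrite (zmode_hom _ _ ku); apply: wtle_nsum; first exact: fin1_hmode.
move=> i; apply: wtleZ; apply: wtle_weaken (wtle_vop (n := i%:Z - n) (wtle_hom ku) bv); lia.
Qed.

Lemma hmode_top a b n u v : wt_space a u -> wt_space b v ->
  wtle (a + b + n - 2) (zmode n u v - vop u (- n) v).
Proof.
move=> au bv; rewrite (zmode_hom _ _ au) /hmode nsum_recl; last exact: fin1_hmode.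
rewrite zbinom0 scale1r sub0r [X in wtle _ X]addrAC subrr add0r.
apply: wtle_nsum; first exact: (fin1_S (fin1_hmode a n u v)).
move=> i; apply: wtleZ.
by apply: wtle_weaken (wtle_vop (n := i.+1%:Z - n) (wtle_hom au) (wtle_hom bv)); lia.
Qed.

Lemma Eop_top p v : wtle p v -> wt_comp (Eop v) p = p%:~R *: wt_comp v p.
Proof.
move=> pv; rewrite /Eop nsum_recl; last exact: fin1_Lop.
rewrite scale1r wt_compD Lop0_comp -[RHS]addr0; congr (_ + _).
suff /(_ p) : wtle (p - 1) (nsum (fun j => log_coef R j.+1 *: Lop j.+1 v)).
  by apply; lia.
apply: wtle_nsum; first exact: (fin1_S (fin1_Lop (log_coef R) v)).
by move=> j; apply: wtleZ; apply: wtle_weaken (wtle_Lop (j := j.+1) pv); lia.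
Qed.

Lemma Eop_eigen_eq0 m v : wtle (m - 1) v -> Eop v = m%:~R *: v -> v = 0.
Proof.
move=> mv Ev.
apply: (wtle_descent (Q := fun v => wtle (m - 1) v /\ Eop v = m%:~R *: v)) => // p {mv Ev}v [mv Ev] pv.
have [pm|mp] := ltP p m; last by apply: mv; lia.
have := Eop_top pv; rewrite Ev wt_compZ => /eqP.
rewrite -subr_eq0 -scalerBl scaler_eq0 => /orP[|/eqP //].
by rewrite subr_eq0 => /eqP /intr_inj E; move: pm; rewrite E ltxx.
Qed.

End WeightFiltration.

(** * The operator U *)

Section CoordinateChange.
Variables (R : realType) (V : voaType R).
Local Notation K := (R[i]).
Local Notation kappa := (two_pi_i R).
Local Notation c := (log_coef R).
Implicit Types u v w z : V.

(* The part of U lowering weights by n, up to (2 pi i)^L(0): comparing weights in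
   E U = U L(0) gives n U_n = sum_(0 < j <= n) c_j L(j) U_(n-j). *)
Fixpoint Ustep (fuel n : nat) v : V :=
  if fuel is fuel'.+1 then
    if n is n'.+1 then
      n%:R^-1 *: \sum_(j < n) c j.+1 *: Lop j.+1 (Ustep fuel' (n' - j) v)
    else v
  else v.

Definition Udeg n v := Ustep n n v.

(** The recursion for U_n refers to all smaller degrees and is not structural in n, hence the fuel;
    any fuel at least n gives the same value. *)
Lemma Ustep_fuel m n v : (n <= m)%N -> Ustep m n v = Udeg n v.
Proof.
rewrite /Udeg; elim/ltn_ind: n m => -[|n] IHn [|m] //= nm.
congr (_ *: _); apply: eq_bigr => j _; congr (_ *: Lop _ _).
by rewrite !IHn //; lia.
Qed.

Lemma UdegS n v : n.+1%:R *: Udeg n.+1 v =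
  \sum_(j < n.+1) c j.+1 *: Lop j.+1 (Udeg (n - j) v).
Proof.
rewrite /Udeg /= scalerA divff ?scale1r ?natS_neq0 //.
apply: eq_bigr => j _; congr (_ *: Lop _ _); apply: Ustep_fuel; exact: leq_subr.
Qed.

Lemma Udeg_inj n (x y : V) : n.+1%:R *: x = n.+1%:R *: y -> x = y.
Proof. by move=> /(scalerI (natS_neq0 R n)). Qed.

Lemma UdegD n u v : Udeg n (u + v) = Udeg n u + Udeg n v.
Proof.
elim/ltn_ind: n => -[//|n] IHn; apply: (@Udeg_inj n); rewrite scalerDr !UdegS -big_split.
apply: eq_bigr => j _; rewrite IHn ?LopD ?scalerDr //; lia.
Qed.

Lemma UdegZ n a v : Udeg n (a *: v) = a *: Udeg n v.
Proof.
elim/ltn_ind: n => -[//|n] IHn; apply: (@Udeg_inj n).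
rewrite [RHS]scalerA [_ * a]mulrC -[RHS]scalerA !UdegS scaler_sumr.
by apply: eq_bigr => j _; rewrite IHn ?LopZ ?scalerA 1?[c _ * a]mulrC //; lia.
Qed.

Lemma Udeg0 n : Udeg n 0 = 0.
Proof. by have := UdegZ n 0 0; rewrite !scale0r. Qed.

Lemma wt_space_sum m n (F : 'I_n -> V) : (forall i, wt_space m (F i)) ->
  wt_space m (\sum_(i < n) F i).
Proof. by move=> mF; elim/big_ind: _ => //; [exact: wt_space0|exact: wt_spaceD]. Qed.

Lemma Udeg_wt a n v : wt_space a v -> wt_space (a - n%:Z) (Udeg n v).
Proof.
move=> av; elim/ltn_ind: n => -[|n] IHn; first by rewrite subr0.
suff H : wt_space (a - n.+1%:Z) (n.+1%:R *: Udeg n.+1 v).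
  have := wt_spaceZ n.+1%:R^-1 H.
  by rewrite scalerA mulVf ?scale1r ?natS_neq0.
rewrite UdegS; apply: wt_space_sum => j; apply: wt_spaceZ.
have jn : (n - j < n.+1)%N by lia.
have := Lop_wt j.+1 (IHn _ jn); congr wt_space.
have := ltn_ord j; lia.
Qed.

Lemma fin1_Udeg v : fin1 (Udeg ^~ v).
Proof.
elim/hom_ind: v => [|x y Px Py|a x ax].
- by exists 0%N => n _; rewrite Udeg0.
- have [N HN] := fin1D Px Py; exists N => n Hn; rewrite UdegD; exact: HN.
have [N HN] := @wt_space_bounded R V; exists (absz (a - N + 1)) => n Hn.
by apply: (HN (a - n%:Z)); [lia|exact: Udeg_wt].
Qed.

Definition Uexp v := nsum (Udeg ^~ v).

Lemma UexpD u v : Uexp (u + v) = Uexp u + Uexp v.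
Proof.
rewrite /Uexp -nsumD; [|exact: fin1_Udeg..].
by apply: eq_nsum => n; rewrite UdegD.
Qed.

Lemma UexpZ a v : Uexp (a *: v) = a *: Uexp v.
Proof.
rewrite /Uexp -nsumZ; last exact: fin1_Udeg.
by apply: eq_nsum => n; rewrite UdegZ.
Qed.

(** In degree n, L(0) contributes (a - n) U_n v, and the terms c_j L(j) U_(n-j) v with j > 0
    contribute n U_n v by the defining recursion. *)
Lemma Eop_Uexp a v : wt_space a v -> Eop (Uexp v) = a%:~R *: Uexp v.
Proof.
move=> av; rewrite /Uexp -nsumZ; last exact: fin1_Udeg.
have F2 : fin2 (fun j n : nat => c j *: Lop j (Udeg n v)).
  apply: fin2Z; apply: fin2_sym; apply: fin2_intro.
    by have [N HN] := fin1_Udeg v; exists N => i j Hi; rewrite HN ?Lop0r.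
  by move=> n; have [N HN] := Lop_trunc (Udeg n v); exists N => j Hj; exact: HN.
transitivity (nsum (fun j => nsum (fun n => c j *: Lop j (Udeg n v)))).
  apply: eq_nsum => j; rewrite (@nsum_morph _ _ (fun x => c j *: Lop j x)) //.
  - by rewrite Lop0r scaler0.
  - by move=> x y; rewrite LopD scalerDr.
  - exact: fin1_Udeg.
rewrite nsum_diag //; apply: eq_nsum => n.
rewrite big_ord_recl /= scale1r subn0 (Lop0_wt (Udeg_wt n av)).
have -> : \sum_(j < n) c (bump 0 j) *: Lop (bump 0 j) (Udeg (n - bump 0 j) v)
        = n%:R *: Udeg n v.
  case: n => [|n]; first by rewrite big_ord0 scale0r.
  by rewrite UdegS; apply: eq_bigr => j _; rewrite subSS.
by rewrite -scalerDl -[n%:R]/(n%:~R) -rmorphD subrK.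
Qed.

(** The operator (2 pi i)^L(0). *)
Definition scale_wt v : V := \sum_(m \in [set: int]) kappa ^ m *: wt_comp v m.

Lemma scale_wt_hom a v : wt_space a v -> scale_wt v = kappa ^ a *: v.
Proof.
move=> av; rewrite /scale_wt (wt_comp_hom av) (@fsum1 _ _ a) ?eqxx // => m /negPf ->.
by rewrite scaler0.
Qed.

Lemma finsupp_scale_wt v : finsupp (fun m => kappa ^ m *: wt_comp v m).
Proof.
have [_ H _] := wt_compP v; apply: sub_finite_set H => m /=.
by apply: contraNneq => ->; rewrite scaler0.
Qed.

Lemma scale_wtD u v : scale_wt (u + v) = scale_wt u + scale_wt v.
Proof.
rewrite /scale_wt -fsumD; [|exact: finsupp_scale_wt..].
by apply: eq_fsbigr => m _; rewrite wt_compD scalerDr.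
Qed.

Lemma scale_wtZ a v : scale_wt (a *: v) = a *: scale_wt v.
Proof.
rewrite /scale_wt (@fsum_morph _ _ _ ( *:%R a)) ?scaler0 //.
- by apply: eq_fsbigr => m _; rewrite wt_compZ !scalerA mulrC.
- by move=> x y; rewrite scalerDr.
- exact: finsupp_scale_wt.
Qed.

Definition Uop v := Uexp (scale_wt v).

Fact Uop_is_linear : linear Uop.
Proof. by move=> a u v; rewrite /Uop scale_wtD scale_wtZ UexpD UexpZ. Qed.

HB.instance Definition _ := GRing.isLinear.Build K V V *:%R Uop Uop_is_linear.

Lemma UopD u v : Uop (u + v) = Uop u + Uop v. Proof. exact: raddfD. Qed.
Lemma UopZ a v : Uop (a *: v) = a *: Uop v. Proof. exact: linearZ_LR. Qed.
Lemma Uop0 : Uop 0 = 0. Proof. exact: raddf0. Qed.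

Lemma Uop_hom a v : wt_space a v -> Uop v = kappa ^ a *: Uexp v.
Proof. by move=> av; rewrite /Uop (scale_wt_hom av) UexpZ. Qed.

Lemma Eop_Uop v : Eop (Uop v) = Uop (Lop 0 v).
Proof.
elim/hom_ind: v => [|x y Px Py|a x ax].
- by rewrite Lop0r Uop0 Eop0.
- by rewrite LopD !UopD EopD Px Py.
rewrite (Uop_hom ax) EopZ (Eop_Uexp ax) (Lop0_wt ax) UopZ (Uop_hom ax).
by rewrite !scalerA mulrC.
Qed.

Lemma Udeg_vacuum n : Udeg n.+1 vacuum = 0.
Proof.
elim/ltn_ind: n => n IHn; apply: (@Udeg_inj n); rewrite scaler0 UdegS big1 // => j _.
have [->|jn] := eqVneq (n - j)%N 0%N.
  by rewrite /Udeg /= /Lop vop_creation_reg ?scaler0 //; lia.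
rewrite (_ : (n - j)%N = (n - j).-1.+1) ?IHn ?Lop0r ?scaler0 //; last by rewrite prednK // lt0n.
by move: jn; rewrite -lt0n; lia.
Qed.

Lemma Uop_vacuum : Uop vacuum = vacuum.
Proof.
rewrite (Uop_hom vacuum_wt) expr0z scale1r /Uexp.
by rewrite (nsum1 (p := 0%N)) // => -[//|n] _; exact: Udeg_vacuum.
Qed.

Lemma kappa_neq0 : kappa != 0.
Proof.
rewrite /two_pi_i mulf_neq0 //; apply/eqP => -[].
  by apply/eqP; rewrite mulf_neq0 ?gt_eqF ?pi_gt0.
by apply/eqP; rewrite oner_neq0.
Qed.

Lemma Uop_top p v : wtle p v -> wtle (p - 1) (Uop v - kappa ^ p *: wt_comp v p).
Proof.
apply: (wtle_ind (P := fun v => wtle (p - 1) (Uop v - kappa ^ p *: wt_comp v p))) => [|x y Px Py|k x kp kx].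
- by rewrite Uop0 wt_comp0 scaler0 subr0; exact: wtle0.
- by rewrite UopD wt_compD scalerDr opprD addrACA; exact: wtleD.
have H : wtle (k - 1) (Uop x - kappa ^ k *: x).
  rewrite (Uop_hom kx) -scalerBr; apply: wtleZ.
  rewrite /Uexp nsum_recl; last exact: fin1_Udeg.
  rewrite addrAC subrr add0r; apply: wtle_nsum; first exact: (fin1_S (fin1_Udeg x)).
  by move=> n; apply: wtle_weaken (wtle_hom (Udeg_wt n.+1 kx)); lia.
rewrite (wt_comp_hom kx); have [->|pk] := eqVneq p k; first exact: H.
rewrite scaler0 subr0 -[Uop x](subrK (kappa ^ k *: x)).
apply: wtleD; first by apply: wtle_weaken H; lia.
by apply/wtleZ; apply: wtle_weaken (wtle_hom kx); lia.
Qed.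

Lemma wtle_Uop p v : wtle p v -> wtle p (Uop v).
Proof.
move=> pv; rewrite -[Uop v](subrK (kappa ^ p *: wt_comp v p)); apply: wtleD.
  by apply: wtle_weaken (Uop_top pv); lia.
by apply/wtleZ/wtle_hom; have [] := wt_compP v.
Qed.

Lemma wt_comp_Uop p v : wtle p v -> wt_comp (Uop v) p = kappa ^ p *: wt_comp v p.
Proof.
move=> /Uop_top /(_ p); rewrite wt_compD -scaleN1r wt_compZ wt_compZ.
have [/(_ p) /wt_comp_hom -> _ _] := wt_compP v; rewrite eqxx scaleN1r => H.
by apply/eqP; rewrite -subr_eq0 H //; lia.
Qed.

Lemma Uop_inj v : Uop v = 0 -> v = 0.
Proof.
apply: (wtle_descent (Q := fun v => Uop v = 0)) => p {}v Uv pv.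
have := wt_comp_Uop pv; rewrite Uv wt_comp0 => /esym/eqP.
by rewrite scaler_eq0 expfz_eq0 (negPf kappa_neq0) andbF /= => /eqP.
Qed.

(** The top component of v is matched by U applied to a multiple of it, which leaves a remainder of
    smaller weight; boundedness below ends the process. *)
Lemma Uop_surj v : exists u, Uop u = v.
Proof.
have [N HN] := @wtle_bounded R V; have [m mv] := wtle_exists v.
have mN : m <= N - 1 + (absz (m - N + 1))%:Z by lia.
(* The induction is on the distance k between the bound on the weights of v and the bound below
   which only 0 remains. *)
move: mN (wtle_weaken mN mv) => _ {mv}; move: (absz _) => k.
elim: k v => [|k IHk] v kv; first by exists 0; rewrite Uop0 (HN v) // -[N - 1]addr0.
pose p : int := N - 1 + k.+1%:Z; pose x := (kappa ^ p)^-1 *: wt_comp v p.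
have px : wt_space p x by apply: wt_spaceZ; have [] := wt_compP v.
have [y Hy] : exists y, Uop y = v - Uop x.
  apply: IHk; rewrite (_ : _ + _ = p - 1); last by rewrite /p; lia.
  apply: wtle_pred; first exact: wtleB (wtle_Uop (wtle_hom px)).
  rewrite wt_compD -scaleN1r wt_compZ (wt_comp_Uop (wtle_hom px)) (wt_comp_hom px) eqxx.
  by rewrite /x scalerA divff ?scale1r ?scaleN1r ?subrr // expfz_neq0 // kappa_neq0.
by exists (y + x); rewrite UopD Hy subrK.
Qed.

End CoordinateChange.

(** * Formal power series *)

(* A copy of nat -> K whose product is the convolution. *)
Definition fps (K : fieldType) : Type := nat -> K.

Section FpsRing.
Variable K : fieldType.
Implicit Types f g h : fps K.

HB.instance Definition _ := gen_eqMixin (fps K).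
HB.instance Definition _ := gen_choiceMixin (fps K).

Definition fps_add f g : fps K := fun n => f n + g n.
Definition fps_opp f : fps K := fun n => - f n.
Definition fps_zero : fps K := fun=> 0.

Fact fps_addA : associative fps_add.
Proof. by move=> f g h; apply: funext => n; rewrite /fps_add addrA. Qed.
Fact fps_addC : commutative fps_add.
Proof. by move=> f g; apply: funext => n; rewrite /fps_add addrC. Qed.
Fact fps_add0 : left_id fps_zero fps_add.
Proof. by move=> f; apply: funext => n; rewrite /fps_add add0r. Qed.
Fact fps_addN : left_inverse fps_zero fps_opp fps_add.
Proof. by move=> f; apply: funext => n; rewrite /fps_add addNr. Qed.

HB.instance Definition _ := GRing.isZmodule.Build (fps K) fps_addA fps_addC fps_add0 fps_addN.

(** The coefficients of a product up to degree n depend only on the truncations of its factors, so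
    associativity and commutativity are inherited degree by degree from [{poly K}]. *)
Definition fps_trunc (n : nat) f : {poly K} := \poly_(i < n.+1) f i.

Lemma fps_mul_trunc n k f g : (k <= n)%N ->
  fps_mul f g k = (fps_trunc n f * fps_trunc n g)`_k.
Proof.
move=> kn; rewrite coefM; apply: eq_bigr => i _.
have ik := ltn_ord i.
by rewrite !coef_poly !ifT //; lia.
Qed.

Lemma fps_trunc_mul n f g i : (i <= n)%N ->
  (fps_trunc n (fps_mul f g))`_i = (fps_trunc n f * fps_trunc n g)`_i.
Proof. by move=> i_n; rewrite coef_poly ltnS i_n (fps_mul_trunc _ _ i_n). Qed.

Fact fps_mulA : associative (@fps_mul K).
Proof.
move=> f g h; apply: funext => n; rewrite !(fps_mul_trunc (n := n)) //.
transitivity ((fps_trunc n f * (fps_trunc n g * fps_trunc n h))`_n).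
  by rewrite !coefM; apply: eq_bigr => i _; rewrite fps_trunc_mul // leq_subr.
rewrite mulrA coefM [RHS]coefM; apply: eq_bigr => i _.
by rewrite fps_trunc_mul // -ltnS.
Qed.

Fact fps_mulC : commutative (@fps_mul K).
Proof.
by move=> f g; apply: funext => n; rewrite !(fps_mul_trunc (n := n)) // mulrC.
Qed.

Fact fps_mul1 : left_id (@fps_one K) (@fps_mul K).
Proof.
move=> f; apply: funext => n; rewrite /fps_mul big_ord_recl subn0 mul1r big1 ?addr0 //.
by move=> i _; rewrite /fps_one mul0r.
Qed.

Fact fps_mulDl : left_distributive (@fps_mul K) +%R.
Proof.
move=> f g h; apply: funext => n; rewrite -[RHS]/(fps_mul f h n + fps_mul g h n).
by rewrite /fps_mul -big_split; apply: eq_bigr => i _; exact: mulrDl.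
Qed.

Fact fps_one_neq0 : (@fps_one K : fps K) != 0.
Proof.
apply/eqP => /(congr1 (fun f : fps K => f 0%N)) /eqP.
by rewrite /fps_one oner_eq0.
Qed.

HB.instance Definition _ := GRing.Zmodule_isComNzRing.Build (fps K)
  fps_mulA fps_mulC fps_mul1 fps_mulDl fps_one_neq0.

Lemma fpsD f g n : (f + g) n = f n + g n. Proof. by []. Qed.
Lemma fpsN f n : (- f) n = - f n. Proof. by []. Qed.
Lemma fpsB f g n : (f - g) n = f n - g n. Proof. by []. Qed.
Lemma fpsM f g n : (f * g) n = \sum_(i < n.+1) f i * g (n - i)%N. Proof. by []. Qed.
Lemma fps1E n : (1 : fps K) n = (n == 0)%:R. Proof. by []. Qed.
Lemma fps_sum I (r : seq I) (P : pred I) (F : I -> fps K) n :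
  (\sum_(i <- r | P i) F i) n = \sum_(i <- r | P i) F i n.
Proof. by elim/big_rec2: _ => // i x y _ <-. Qed.

Lemma fps_expE f k : fps_exp f k = (f : fps K) ^+ k.
Proof. by elim: k => //= k IHk; rewrite exprS -IHk. Qed.

Definition fps_const (a : K) : fps K := fun n => a *+ (n == 0)%N.
Definition fps_X : fps K := fun n => (n == 1)%:R.

Lemma fps_constM a f n : (fps_const a * f) n = a * f n.
Proof.
rewrite fpsM big_ord_recl subn0 big1 ?addr0 // => i _.
by rewrite /fps_const mulr0n mul0r.
Qed.

Lemma fps_XM0 f : (fps_X * f) 0%N = 0.
Proof. by rewrite fpsM big_ord1 mul0r. Qed.

Lemma fps_XMS f n : (fps_X * f) n.+1 = f n.
Proof.
rewrite fpsM 2!big_ord_recl mul0r add0r /= mul1r subSS subn0 big1 ?addr0 // => i _.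
by rewrite /fps_X mul0r.
Qed.

Lemma fps_XnM k f n : (fps_X ^+ k * f) n = if (n < k)%N then 0 else f (n - k)%N.
Proof.
elim: k n f => [|k IHk] n f; first by rewrite mul1r subn0.
rewrite exprS -mulrA; case: n => [|n]; first by rewrite fps_XM0.
by rewrite fps_XMS IHk subSS.
Qed.

Lemma fps_X_div f : f 0%N = 0 -> f = fps_X * (fun n => f n.+1).
Proof. by move=> f0; apply: funext => -[|n]; rewrite ?fps_XM0 ?fps_XMS. Qed.

(** Congruence modulo X^N. It lets a series in powers of some f with [f 0 = 0] be replaced by a
    finite sum, so that no infinite sum of series and no substitution is formed. *)
Definition fps_eqmod N f g := forall k, (k < N)%N -> f k = g k.

Lemma eqmodD N f f' g g' : fps_eqmod N f f' -> fps_eqmod N g g' ->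
  fps_eqmod N (f + g) (f' + g').
Proof. by move=> ff gg k kN; rewrite !fpsD ff ?gg. Qed.

Lemma eqmodMl N h f g : fps_eqmod N f g -> fps_eqmod N (h * f) (h * g).
Proof.
move=> fg k kN; rewrite !fpsM; apply: eq_bigr => i _; rewrite fg //.
by apply: leq_ltn_trans kN; exact: leq_subr.
Qed.

Lemma eqmod_Xn N f : fps_eqmod N (fps_X ^+ N * f) 0.
Proof. by move=> k kN; rewrite fps_XnM kN. Qed.

Lemma eqmod_exp N f g : f 0%N = 0 -> fps_eqmod N (f ^+ N * g) 0.
Proof.
by move=> /fps_X_div ->; rewrite exprMn -mulrA; exact: eqmod_Xn.
Qed.

Lemma eqmod_X_cancel N f g : fps_eqmod N.+1 (fps_X * f) (fps_X * g) -> fps_eqmod N f g.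
Proof. by move=> fg k kN; have := fg k.+1 kN; rewrite !fps_XMS. Qed.

Lemma eqmod_weaken M N f g : (M <= N)%N -> fps_eqmod N f g -> fps_eqmod M f g.
Proof. by move=> MN fg k kM; apply: fg; lia. Qed.

Lemma fps_mulfV f : f 0%N != 0 -> f * fps_inv f = 1.
Proof.
move=> f0; pose h : fps K := 1 - fps_const (f 0%N)^-1 * f.
have h0 : h 0%N = 0 by rewrite /h fpsB fps_constM mulVf // subrr.
have E : f = fps_const (f 0%N) * (1 - h).
  rewrite /h subKr mulrA; apply: funext => n.
  by rewrite -mulrA !fps_constM mulrA mulfV // mul1r.
(* In degree n, [fps_inv] stops the geometric series at k = n; extending it to a common length N
   changes nothing, as h^k is divisible by X^k. *)
have invE N : fps_eqmod N (fps_inv f) (fps_const (f 0%N)^-1 * \sum_(k < N) h ^+ k).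
  move=> n nN; rewrite fps_constM fps_sum /fps_inv; congr (_ * _).
  rewrite (big_ord_widen N (fun k => fps_exp (fun j => fps_one K j - (f 0%N)^-1 * f j) k n)) //.
  rewrite big_mkcond; apply: eq_bigr => k _; rewrite fps_expE.
  have -> : (fun j => fps_one K j - (f 0%N)^-1 * f j) = h.
    by apply: funext => j; rewrite /h fpsB fps_constM.
  case: ltnP => // nk; have := eqmod_exp 1 h0 (N := k); rewrite mulr1 => -> //.
apply: funext => n.
rewrite (eqmodMl f (invE n.+1)) // mulrCA [X in _ * (X * _)]E -[X in _ * X]mulrA -[(1 - h) * _]opprK.
rewrite -mulNr opprB -subrX1 mulrA opprB mulrBr mulr1.
have -> : fps_const (f 0%N)^-1 * fps_const (f 0%N) = 1.
  by apply: funext => k; rewrite fps_constM /fps_const mulrnAr mulVf.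
rewrite mul1r fpsB.
by have := eqmod_exp 1 h0 (N := n.+1); rewrite mulr1 => -> //; rewrite subr0.
Qed.

(** The derivation x d/dx, which unlike d/dx does not shift degrees. *)
Definition fps_theta f : fps K := fun n => n%:R * f n.

Lemma thetaD f g : fps_theta (f + g) = fps_theta f + fps_theta g.
Proof. by apply: funext => n; rewrite fpsD /fps_theta fpsD mulrDr. Qed.

Lemma thetaM f g : fps_theta (f * g) = fps_theta f * g + f * fps_theta g.
Proof.
apply: funext => n; rewrite fpsD /fps_theta !fpsM mulr_sumr -big_split.
apply: eq_bigr => i _; have /subnKC {1}<- : (i <= n)%N by rewrite -ltnS.
by rewrite natrD /=; ring.
Qed.

Lemma theta1 : fps_theta 1 = 0.
Proof. by apply: funext => -[|n]; rewrite /fps_theta fps1E ?mul0r ?mulr0. Qed.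

Lemma theta0 : fps_theta 0 = 0.
Proof. by apply: funext => n; rewrite /fps_theta mulr0. Qed.

Lemma theta_const a f : fps_theta (fps_const a * f) = fps_const a * fps_theta f.
Proof.
by apply: funext => n; rewrite /fps_theta !fps_constM mulrCA.
Qed.

Lemma thetaX : fps_theta fps_X = fps_X.
Proof.
by apply: funext => n; rewrite /fps_theta /fps_X; case: eqP => [->|_]; rewrite ?mulr1 ?mulr0.
Qed.

Lemma theta_sum I (r : seq I) (P : pred I) (F : I -> fps K) :
  fps_theta (\sum_(i <- r | P i) F i) = \sum_(i <- r | P i) fps_theta (F i).
Proof. by apply: (big_morph _ thetaD theta0). Qed.

Lemma thetaXn f n : fps_theta (f ^+ n.+1) = n.+1%:R * f ^+ n * fps_theta f.
Proof.
elim: n => [|n IHn]; first by rewrite !expr0 mul1r mul1r.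
have -> : n.+2%:R = n.+1%:R + 1 :> fps K by rewrite natr1.
by rewrite exprS thetaM IHn exprS; ring.
Qed.

End FpsRing.

(** * The series e^(2 pi i x) and the powers of e^(2 pi i x) - 1 *)

Section ExponentialSeries.
Variable R : realType.
Local Notation K := (R[i]).
Local Notation kappa := (two_pi_i R).
Local Notation c := (log_coef R).
Local Notation const := (@fps_const K).
Local Notation X := (fps_X K).
Local Notation q := (exp_2pi_i R : fps K).
Local Notation g := (exp_2pi_i_sub1_divx R : fps K).

Definition inv_g : fps K := fps_inv g.

Lemma factC_neq0 n : n`!%:R != 0 :> K.
Proof. by move/pcharf0P: (charC0 R) => ->; rewrite -lt0n fact_gt0. Qed.

Lemma mul_inv_g : g * inv_g = 1.
Proof.
apply: fps_mulfV; rewrite /exp_2pi_i_sub1_divx /exp_2pi_i expr1 divr1.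
exact: kappa_neq0.
Qed.

Lemma theta_q : fps_theta q = const kappa * X * q.
Proof.
apply: funext => -[|n]; rewrite /fps_theta -mulrA fps_constM.
  by rewrite fps_XM0 mul0r mulr0.
rewrite fps_XMS /exp_2pi_i exprS factS natrM.
have := natS_neq0 R n; have := factC_neq0 n.
move: (n.+1%:R : K) (n`!%:R : K) => x z z0 x0.
by field; rewrite x0 z0.
Qed.

Lemma Xg : X * g = q - 1.
Proof.
apply: funext => -[|n]; rewrite fpsB fps1E.
  by rewrite fps_XM0 /exp_2pi_i expr0 divr1 subrr.
by rewrite fps_XMS subr0.
Qed.

Lemma fps_X_inj (f h : fps K) : X * f = X * h -> f = h.
Proof. by move=> E; apply: funext => n; rewrite -(fps_XMS f n) E fps_XMS. Qed.

Lemma theta_g : fps_theta g = const kappa * q - g.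
Proof.
apply: fps_X_inj; apply: (addrI (X * g)).
have := congr1 (@fps_theta K) Xg.
rewrite thetaM thetaX thetaD theta_q (_ : fps_theta (- 1) = 0); last first.
  by apply: funext => -[|n]; rewrite /fps_theta fpsN fps1E ?mul0r // oppr0 mulr0.
by rewrite addr0 => ->; ring.
Qed.

Lemma theta_inv_g : fps_theta inv_g = - inv_g ^+ 2 * fps_theta g.
Proof.
have := congr1 (@fps_theta K) mul_inv_g; rewrite theta1 thetaM => E.
have E1 : fps_theta inv_g = inv_g * (g * fps_theta inv_g).
  by rewrite mulrA [inv_g * g]mulrC mul_inv_g mul1r.
rewrite E1; move/eqP: E; rewrite addrC addr_eq0 => /eqP ->; ring.
Qed.

(* g^(-n) *)
Definition gpow (n : int) : fps K :=
  if n is Posz m then inv_g ^+ m else g ^+ `|n|.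

Lemma gpow_pred n : gpow (n - 1) = gpow n * g.
Proof.
case: n => [[|n]|n].
- by rewrite mul1r.
- rewrite (_ : n.+1%:Z - 1 = n); last lia.
  by rewrite /= exprS mulrAC [inv_g * g]mulrC mul_inv_g mul1r.
rewrite (_ : Negz n - 1 = Negz n.+1); last lia.
by rewrite /= exprS mulrC.
Qed.

Lemma gpowB n (j : nat) : gpow (n - j%:Z) = gpow n * g ^+ j.
Proof.
elim: j => [|j IHj]; first by rewrite subr0 mulr1.
rewrite (_ : n - j.+1%:Z = n - j%:Z - 1); last lia.
by rewrite gpow_pred IHj exprSr mulrA.
Qed.

Lemma theta_gpow n : fps_theta (gpow n) = - n%:~R * gpow n * inv_g * fps_theta g.
Proof.
case: n => [[|n]|n] /=.
- by rewrite expr0 theta1 oppr0 !mul0r.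
- by rewrite thetaXn theta_inv_g [inv_g ^+ n.+1]exprS -pmulrn; ring.
rewrite thetaXn NegzE rmorphN /= opprK -pmulrn exprS.
transitivity (n.+1%:R * g ^+ n * (g * inv_g) * fps_theta g); last by ring.
by rewrite mul_inv_g mulr1.
Qed.

(* The coefficients of x^n q (q - 1)^(-n) *)
Definition qgpow (n : int) : fps K := q * gpow n.

(** A logarithmic derivative: x q' / q = 2 pi i x and x g' / g = 2 pi i q / g - 1. *)
Lemma theta_qgpow n :
  fps_theta (qgpow n) =
  qgpow n * (const kappa * X - n%:~R * (const kappa * q * inv_g - 1)).
Proof.
rewrite thetaM theta_q theta_gpow theta_g /qgpow.
transitivity (q * gpow n * (const kappa * X - n%:~R * (const kappa * q * inv_g - g * inv_g))).
  by ring.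
by rewrite mul_inv_g.
Qed.

Local Notation y := (q - 1).

Lemma y0 : y 0%N = 0.
Proof. by rewrite -Xg fps_XM0. Qed.

(* With l(y) = (1 + y) log (1 + y), the truncations of l'(y) and of l(y) / y. *)
Definition logA N := \sum_(j < N) const (c j * j.+1%:R) * y ^+ j.
Definition logM N := \sum_(j < N) const (c j) * y ^+ j.

Lemma theta_y : fps_theta y = const kappa * X * (1 + y).
Proof.
rewrite thetaD theta_q (_ : fps_theta (- 1) = 0) ?addr0.
  by ring.
by apply: funext => -[|n]; rewrite /fps_theta fpsN fps1E ?mul0r // oppr0 mulr0.
Qed.

Lemma constM a b (f : fps K) : const (a * b) * f = const a * (const b * f).
Proof. by apply: funext => n; rewrite !fps_constM mulrA. Qed.

Lemma const1 : const 1 = 1.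
Proof. by apply: funext => n; rewrite /fps_const fps1E. Qed.

Lemma const_nat n : const n%:R = n%:R.
Proof.
elim: n => [|n IHn]; first by apply: funext => n; rewrite /fps_const mul0rn.
by rewrite -[RHS]natr1 -IHn -const1; apply: funext => k; rewrite fpsD /fps_const -natr1 mulrnDl.
Qed.

(** Since l''(y) = 1 / (1 + y) and x dy/dx = 2 pi i x (1 + y), applying x d/dx to l'(y) gives 2 pi i
    x; truncation leaves the error of a finite geometric sum. *)
Lemma logA_theta N :
  fps_theta (logA N.+1) = const kappa * X * (1 - (- y) ^+ N).
Proof.
rewrite /logA big_ord_recl expr0 mulr1 mul1r const1 thetaD theta1 add0r theta_sum.
have -> : 1 - (- y) ^+ N = (1 + y) * \sum_(j < N) (- y) ^+ j.
  by rewrite -[LHS]opprB subrX1 -mulNr opprB opprK.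
rewrite mulrA -theta_y mulr_sumr; apply: eq_bigr => j _.
rewrite theta_const lift0 thetaXn.
have -> : const (c j.+1 * j.+2%:R) * (j.+1%:R * y ^+ j * fps_theta y) =
   const (c j.+1 * j.+2%:R * j.+1%:R) * (y ^+ j * fps_theta y).
  by rewrite [in RHS]constM const_nat; ring.
have -> : c j.+1 * j.+2%:R * j.+1%:R = (-1) ^+ j.
  rewrite log_coefS; have := natS_neq0 R j; have := natS_neq0 R j.+1.
  move: (j.+1%:R : K) (j.+2%:R : K) => x z z0 x0.
  by field; rewrite x0 z0.
have -> : const ((-1) ^+ j) = (-1) ^+ j.
  elim: (nat_of_ord j) => [|n IHn]; first by rewrite const1.
  rewrite !exprS -IHn -[const _]mulr1 constM mulr1; congr (_ * _).
  by apply: funext => k; rewrite fpsN fps1E /fps_const mulNrn.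
by rewrite [(- y) ^+ _]exprNn; ring.
Qed.

(** This is l'(y) = 1 + log (1 + y) = 1 + 2 pi i x. The constant terms agree, and in degree k > 0 a
    series is recovered from its image under x d/dx by dividing by k. *)
Lemma logA_eqmod N : fps_eqmod N (logA N) (1 + const kappa * X).
Proof.
case: N => // N k kN.
have [->|k0] := posnP k.
  rewrite /logA fps_sum fpsD fps_constM /fps_X mulr0 addr0 fps1E big_ord_recl.
  rewrite expr0 mulr1 mul1r const1 big1 ?addr0 // => j _.
  by rewrite lift0 fps_constM [(y ^+ _)]exprS fpsM big_ord1 y0 mul0r mulr0.
have := logA_theta N => /(congr1 (fun f : fps K => f k)).
rewrite mulrBr fpsB mulr1 -mulrA.
rewrite (_ : (const kappa * (X * (- y) ^+ N)) k = 0); last first.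
  rewrite fps_constM; case: k k0 kN => // k _ kN; rewrite fps_XMS.
  have := eqmod_exp 1 (f := - y) (N := N); rewrite mulr1 => -> //; first by rewrite mulr0.
  by rewrite fpsN y0 oppr0.
rewrite subr0 fps_constM /fps_theta => E.
have kn0 : k%:R != 0 :> K by rewrite -(prednK k0) natS_neq0.
apply: (mulfI kn0); rewrite E fpsD fps1E fps_constM (gtn_eqF k0) add0r /fps_X.
by case: eqP => [->|_]; rewrite ?mulr1 ?mul1r ?mulr0.
Qed.

(** A finite form of l(y) = (1 + y) (l'(y) - 1): the extra power of y is the mismatch at the end of
    the truncated sums, and [log_coef_rec] gives the induction step. *)
Lemma log_relation N :
  y * logM N.+2 + const (c N.+1 * N.+1%:R) * y ^+ N.+2 = (1 + y) * (logA N.+2 - 1).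
Proof.
have cM a n : const (a * n%:R) = const a * n%:R.
  by rewrite -[const (a * _)]mulr1 constM mulr1 const_nat.
rewrite /logM /logA cM; elim: N => [|N IHN].
  rewrite !big_ord_recl !big_ord0 /bump /= !cM const1.
  have E : const (c 1) * 2%:R = 1.
    have /(congr1 const) := log_coef_rec R 0.
    by rewrite mul0r addr0 mulrC cM const1.
  move: E; move: y (const (c 1)) => z d E.
  transitivity (z + (d * 2%:R) * z ^+ 2); first by ring.
  by rewrite E; ring.
rewrite big_ord_recr /= [in RHS]big_ord_recr /= cM.
have E : N.+3%:R * const (c N.+2) + N.+1%:R * const (c N.+1) = 0.
  have /(congr1 const) := log_coef_rec R N.+1.
  have constD a b : const (a + b) = const a + const b.
    by apply: funext => n; rewrite fpsD /fps_const mulrnDl.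
  rewrite constD [_ * c N.+2]mulrC [_ * c N.+1]mulrC !cM mulrC [_ * N.+1%:R]mulrC => ->.
  by apply: funext => n; rewrite /fps_const mul0rn.
have En : N.+3%:R = N.+2%:R + 1 :> fps K by rewrite natr1.
rewrite [y ^+ N.+3]exprS.
set M := \sum_(j < N.+2) _ in IHN *; set A := \sum_(j < N.+2) _ in IHN *.
move: IHN E En; move: (y ^+ N.+2) (const (c N.+1)) (const (c N.+2)) (N.+1%:R : fps K)
  (N.+2%:R : fps K) (N.+3%:R : fps K) M A; move: y.
move=> z zN d e n1 n2 n3 M A IHN E En.
transitivity (z * M + d * n1 * zN + (1 + z) * (e * n3) * zN - (n3 * e + n1 * d) * zN).
  by rewrite En; ring.
by rewrite IHN E; ring.
Qed.

(** With y = X g, the relation l(y) = 2 pi i x (1 + y) becomes X g (l(y) / y) = 2 pi i X q.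
    Cancelling X loses one order, hence [N.+1] against [N.+2]. *)
Lemma logM_eqmod N : fps_eqmod N.+1 (logM N.+2) (const kappa * q * inv_g).
Proof.
have E1 : fps_eqmod N.+2 (X * (g * logM N.+2)) (X * (const kappa * q)).
  rewrite mulrA Xg; have -> : y * logM N.+2 = (1 + y) * (logA N.+2 - 1)
     + y ^+ N.+2 * - const (c N.+1 * N.+1%:R).
    rewrite -log_relation; move: (const (c _ * _)) (y ^+ _) (y * _) => d z M.
    by ring.
  have -> : X * (const kappa * q) = (1 + y) * (1 + const kappa * X - 1) + 0.
    by move: (const kappa) => d; ring.
  apply: eqmodD; last exact: eqmod_exp y0.
  apply: eqmodMl; apply: eqmodD => //; exact: logA_eqmod.
have := eqmodMl inv_g (eqmod_X_cancel E1).
by rewrite mulrA [inv_g * g]mulrC mul_inv_g mul1r mulrC.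
Qed.

(** Since 2 pi i x q = l(y) and d/dx = 2 pi i q d/dy, the derivative in x of x q y^(-n) is q times
    the derivative in y of l(y) y^(-n); this compares the coefficients of x^(s-n). The proof factors
    the latter derivative as y^(-n) (l'(y) - n l(y) / y). *)
Lemma qgpow_rec n s :
  (s.+1%:Z - n)%:~R * qgpow n s =
  \sum_(j < s.+1) c j * (j.+1%:Z - n)%:~R * qgpow (n - j%:Z) (s - j)%N.
Proof.
(* [logM_eqmod] for length s + 2 is exact through degree s; the extra term j = s + 1 is divisible by
   y^(s+1) and drops out in degree s. *)
pose N := s.+2.
have cM a b : const (a * b) = const a * const b.
  by rewrite -[const (a * _)]mulr1 constM mulr1.
have cint (m : int) : const m%:~R = m%:~R.
  case: m => m; first exact: const_nat.
  by rewrite NegzE !rmorphN /= -!pmulrn -const_nat; apply: funext => k; rewrite fpsN /fps_const mulNrn.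
transitivity ((qgpow n * (logA N - n%:~R * logM N)) s).
  have E : fps_eqmod s.+1 (qgpow n * (logA N - n%:~R * logM N))
      (fps_theta (qgpow n) + const (1 - n)%:~R * qgpow n).
    have -> : fps_theta (qgpow n) + const (1 - n)%:~R * qgpow n =
        qgpow n * (1 + const kappa * X + - n%:~R * (const kappa * q * inv_g)).
      by rewrite theta_qgpow cint rmorphB /=; ring.
    rewrite -mulNr; apply/eqmodMl/eqmodD.
    exact: (@eqmod_weaken _ _ _ _ _ (leqnSn _) (@logA_eqmod N)).
    exact/eqmodMl/logM_eqmod.
  rewrite E // fpsD fps_constM /fps_theta -mulrDl; congr (_ * _).
  by rewrite -[s%:R]/(s%:~R) -rmorphD; congr (_%:~R); lia.
have -> : logA N - n%:~R * logM N = \sum_(j < N) const (c j * (j.+1%:Z - n)%:~R) * y ^+ j.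
  rewrite /logA /logM mulr_sumr -sumrB; apply: eq_bigr => j _.
  by rewrite !cM const_nat cint rmorphB /= -[j.+1%:~R]/(j.+1%:R); ring.
rewrite mulr_sumr fps_sum big_ord_recr /=.
have T (j : nat) : (qgpow n * (const (c j * (j.+1%:Z - n)%:~R) * y ^+ j)) s =
   if (s < j)%N then 0 else c j * (j.+1%:Z - n)%:~R * qgpow (n - j%:Z) (s - j)%N.
  rewrite mulrCA fps_constM -Xg exprMn mulrCA fps_XnM.
  case: ltnP => _; first by rewrite mulr0.
  by rewrite /qgpow gpowB [in RHS]mulrA.
rewrite T ltnSn addr0; apply: eq_bigr => j _.
by rewrite T ltnNge -ltnS ltn_ord.
Qed.

End ExponentialSeries.

(** * Quotient algebras *)

Section QuotientModule.
Local Open Scope quotient_scope.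
Variables (K : pzRingType) (V : lmodType K) (O : set V).
Hypothesis O0 : O 0.
Hypothesis O_linear : forall a u v, O u -> O v -> O (a *: u + v).

Definition sub_pred : {pred V} := fun v => `[< O v >].

Fact sub_pred_closed : zmod_closed sub_pred.
Proof.
split; first exact/asboolP.
move=> u v /asboolP Ou /asboolP Ov; apply/asboolP.
by rewrite addrC -scaleN1r; exact: O_linear.
Qed.

HB.instance Definition _ := GRing.isZmodClosed.Build V sub_pred sub_pred_closed.

Definition quot_module : Type := Quotient.quot sub_pred.
HB.instance Definition _ := GRing.Zmodule.on quot_module.

Definition quot_pi (v : V) : quot_module := \pi_(Quotient.quot sub_pred) v.

Lemma quot_pi_eq u v : quot_pi u = quot_pi v <-> O (u - v).
Proof.
split=> [/eqP|Ouv].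
  by rewrite -Quotient.idealrBE => /asboolP.
by apply/eqP; rewrite -Quotient.idealrBE; exact/asboolP.
Qed.

Lemma quot_piD u v : quot_pi (u + v) = quot_pi u + quot_pi v.
Proof. by rewrite /quot_pi raddfD. Qed.

Definition quot_repr (x : quot_module) : V := generic_quotient.repr x.

Lemma quot_reprK x : quot_pi (quot_repr x) = x.
Proof. exact: reprK. Qed.

Lemma quot_piZ_eq a u v : quot_pi u = quot_pi v -> quot_pi (a *: u) = quot_pi (a *: v).
Proof.
move=> /quot_pi_eq Ouv; apply/quot_pi_eq.
by rewrite -scalerBr -[_ *: _]addr0; exact: O_linear.
Qed.

Definition quot_scale a x := quot_pi (a *: quot_repr x).

Lemma quot_scale_pi a v : quot_scale a (quot_pi v) = quot_pi (a *: v).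
Proof. by apply: quot_piZ_eq; rewrite quot_reprK. Qed.

Fact quot_scaleA a b x : quot_scale a (quot_scale b x) = quot_scale (a * b) x.
Proof. by rewrite -[x]quot_reprK !quot_scale_pi scalerA. Qed.

Fact quot_scale1 : left_id 1 quot_scale.
Proof. by move=> x; rewrite -[x]quot_reprK !quot_scale_pi scale1r. Qed.

Fact quot_scaleDr : right_distributive quot_scale +%R.
Proof.
move=> a x y; rewrite -[x]quot_reprK -[y]quot_reprK -quot_piD !quot_scale_pi.
by rewrite scalerDr quot_piD.
Qed.

Fact quot_scaleDl x : {morph quot_scale^~ x : a b / a + b}.
Proof.
by move=> a b; rewrite -[x]quot_reprK !quot_scale_pi scalerDl quot_piD.
Qed.

HB.instance Definition _ := GRing.Zmodule_isLmodule.Build K quot_module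
  quot_scaleA quot_scale1 quot_scaleDr quot_scaleDl.

Fact quot_pi_is_linear : linear quot_pi.
Proof. by move=> a u v; rewrite quot_piD -quot_scale_pi. Qed.

HB.instance Definition _ := GRing.isLinear.Build K V quot_module *:%R quot_pi
  quot_pi_is_linear.

Lemma quot_pi_eq0 v : quot_pi v = 0 <-> O v.
Proof. by rewrite -[v in O v]subr0 -quot_pi_eq raddf0. Qed.

End QuotientModule.

Section QuotientAlgebra.
Variables (K : pzRingType) (V : lmodType K) (O : set V) (mul : V -> V -> V) (e : V).
Hypothesis O0 : O 0.
Hypothesis O_linear : forall a u v, O u -> O v -> O (a *: u + v).
Hypothesis mul_linearl : forall v, linear (mul ^~ v).
Hypothesis mul_linearr : forall u, linear (mul u).
Hypothesis O_mull : forall u v, O u -> O (mul u v).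
Hypothesis O_mulr : forall u v, O v -> O (mul u v).
Hypothesis mulA_O : forall u v w, O (mul u (mul v w) - mul (mul u v) w).
Hypothesis mule_l : forall v, O (mul e v - v).
Hypothesis mule_r : forall v, O (mul v e - v).

Let Q := quot_module O0 O_linear.
Let p : {linear V -> Q} := quot_pi O0 O_linear.
Let r : Q -> V := @quot_repr K V O O0 O_linear.

Definition quot_mul (x y : Q) : Q := p (mul (r x) (r y)).

Lemma quot_mul_pi u v : p (mul u v) = quot_mul (p u) (p v).
Proof.
apply/quot_pi_eq.
have rp w : O (w - r (p w)) by apply/quot_pi_eq; rewrite quot_reprK.
have mulBl a b c : mul (a - b) c = mul a c - mul b c.
  by rewrite addrC -scaleN1r mul_linearl scaleN1r addrC.
have mulBr a b c : mul a (b - c) = mul a b - mul a c.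
  by rewrite addrC -scaleN1r mul_linearr scaleN1r addrC.
(* With u' and v' the chosen representatives, u v - u' v' = (u - u') v + u' (v - v'). *)
rewrite -(subrKA (mul (r (p u)) v)) -mulBl -mulBr -[X in X + _]scale1r.
by apply: O_linear; [exact: O_mull|exact: O_mulr].
Qed.

Lemma quot_ind (P : Q -> Prop) : (forall v, P (p v)) -> forall x, P x.
Proof. by move=> Pp x; rewrite -[x]quot_reprK; exact: Pp. Qed.

Fact quot_mul_linearl y : linear (quot_mul ^~ y).
Proof.
elim/quot_ind: y => w a; elim/quot_ind => u; elim/quot_ind => v /=.
by rewrite -linearP -!quot_mul_pi mul_linearl linearP.
Qed.

Fact quot_mul_linearr x : linear (quot_mul x).
Proof.
elim/quot_ind: x => w a; elim/quot_ind => u; elim/quot_ind => v /=.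
by rewrite -linearP -!quot_mul_pi mul_linearr linearP.
Qed.

Fact quot_mulA : associative quot_mul.
Proof.
elim/quot_ind => u; elim/quot_ind => v; elim/quot_ind => w.
by rewrite -!quot_mul_pi; apply/quot_pi_eq.
Qed.

Fact quot_mul1l : left_id (p e) quot_mul.
Proof. by elim/quot_ind => v; rewrite -quot_mul_pi; apply/quot_pi_eq. Qed.

Fact quot_mul1r : right_id (p e) quot_mul.
Proof. by elim/quot_ind => v; rewrite -quot_mul_pi; apply/quot_pi_eq. Qed.

Definition quot_assoc_algebra := AssocAlgebra quot_mul_linearl quot_mul_linearr
  quot_mulA quot_mul1l quot_mul1r.

Lemma quotient_algebra_inhabited : inhabited (quotient_algebra O mul e).
Proof.
constructor; apply: (@QuotientAlgebra _ _ _ _ _ quot_assoc_algebra p) => //.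
- by move=> x; exists (r x); exact: quot_reprK.
- by move=> v; exact: quot_pi_eq0.
- exact: quot_mul_pi.
Qed.

End QuotientAlgebra.

(** * Comparison of the two products *)

Section TildeModes.
Variables (R : realType) (V : voaType R).
Local Notation K := (R[i]).
Local Notation kappa := (two_pi_i R).
Local Notation c := (log_coef R).
Implicit Types u v w z : V.

(* tilde_res with n possibly negative *)
Definition tmode (n : int) u v : V :=
  nsum (fun k => (kappa * qgpow R n k) *: vop u (k%:Z - n) v).

Lemma tilde_resE (n : nat) u v : tilde_res n u v = tmode n u v.
Proof.
rewrite /tilde_res /res_vop -/(nsum _); apply: eq_nsum => k.
by rewrite fps_expE.
Qed.

Lemma fin1_tmode n u v : fin1 (fun k => (kappa * qgpow R n k) *: vop u (k%:Z - n) v).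
Proof. by apply: fin1Z; exact: fin1_vop. Qed.

Lemma tmodeDl n u u' v : tmode n (u + u') v = tmode n u v + tmode n u' v.
Proof.
rewrite /tmode -nsumD; [|exact: fin1_tmode..].
by apply: eq_nsum => k; rewrite vopDl scalerDr.
Qed.

Lemma tmodeDr n u v v' : tmode n u (v + v') = tmode n u v + tmode n u v'.
Proof.
rewrite /tmode -nsumD; [|exact: fin1_tmode..].
by apply: eq_nsum => k; rewrite vopDr scalerDr.
Qed.

Lemma tmode0l n v : tmode n 0 v = 0.
Proof. by apply: nsum_eq0 => k; rewrite vop0l scaler0. Qed.

Lemma tmode0r n u : tmode n u 0 = 0.
Proof. by apply: nsum_eq0 => k; rewrite vop0r scaler0. Qed.

Lemma tmode_trunc u v : exists N : nat, forall n, n <= - N%:Z -> tmode n u v = 0.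
Proof.
have [N HN] := vop_trunc_nat u v; exists N => n Hn.
by apply: nsum_eq0 => k; rewrite HN ?scaler0 //; lia.
Qed.

(** The mode u_(k-n) v has weight a + b - (k + 1 - n), and [qgpow_rec] rewrites the factor k + 1 -
    n. The resulting recursion in n has the coefficients of [Eop_zmode]. *)
Lemma Lop0_tmode a b n u v : wt_space a u -> wt_space b v ->
  Lop 0 (tmode n u v) = (a + b)%:~R *: tmode n u v
    - nsum (fun j => (c j * (j.+1%:Z - n)%:~R) *: tmode (n - j%:Z) u v).
Proof.
move=> au bv; pose Y (k : nat) := vop u (k%:Z - n) v.
have Y1 : fin1 Y by exact: fin1_vop.
have -> : nsum (fun j => (c j * (j.+1%:Z - n)%:~R) *: tmode (n - j%:Z) u v) =
  nsum (fun s => (kappa * ((s.+1%:Z - n)%:~R * qgpow R n s)) *: Y s).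
  pose F (j k : nat) := (kappa * (c j * (j.+1%:Z - n)%:~R * qgpow R (n - j%:Z) k)) *: Y (j + k)%N.
  have F2 : fin2 F by have [N HN] := Y1; apply: fin2Z; exists N => j k H; exact: HN.
  transitivity (nsum (fun j => nsum (F j))).
    apply: eq_nsum => j; rewrite -nsumZ; last exact: fin1_tmode.
    apply: eq_nsum => k; rewrite scalerA mulrCA /F /Y.
    by congr (_ *: vop _ _ _); lia.
  rewrite nsum_diag //; apply: eq_nsum => s; rewrite qgpow_rec mulr_sumr scaler_suml.
  by apply: eq_bigr => j _; rewrite /F subnKC // -ltnS.
rewrite /tmode (@nsum_morph _ _ (Lop 0)) ?Lop0r //; last 2 first.
- by move=> x y; rewrite LopD.
- exact: fin1_tmode.
rewrite -nsumZ; last exact: fin1_tmode.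
rewrite -nsumB; [|exact/fin1Z/fin1_tmode|exact/fin1Z].
apply: eq_nsum => k /=; rewrite LopZ (Lop0_wt (vop_wt _ au bv)) !scalerA -scalerBl.
congr (_ *: _).
rewrite (_ : a + b - (k%:Z - n) - 1 = (a + b) - (k.+1%:Z - n)); last lia.
rewrite rmorphB /=; move: (_%:~R : K) (_%:~R : K) (qgpow _ _ _) (two_pi_i R) => x y h d.
by ring.
Qed.

Lemma gpow_0 n : gpow R n 0%N = kappa ^ (- n).
Proof.
have g0 : (exp_2pi_i_sub1_divx R : fps K) 0%N = kappa.
  by rewrite /exp_2pi_i_sub1_divx /exp_2pi_i expr1 divr1.
have pow0 (f : fps K) m : (f ^+ m) 0%N = f 0%N ^+ m.
  elim: m => [|m IHm]; first by rewrite !expr0 fps1E.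
  by rewrite !exprS fpsM big_ord1 IHm.
case: n => n /=; last by rewrite pow0 g0 NegzE opprK.
rewrite pow0 -exprnN -exprVn; congr (_ ^+ _).
apply: (mulfI (kappa_neq0 R)); rewrite divff ?kappa_neq0 //.
by have /(congr1 (fun f : fps K => f 0%N)) := mul_inv_g R; rewrite fpsM big_ord1 g0.
Qed.

Lemma qgpow_0 n : kappa * qgpow R n 0%N = kappa ^ (1 - n).
Proof.
rewrite /qgpow fpsM big_ord1 subn0 gpow_0 /exp_2pi_i expr0 divr1 mul1r.
by rewrite expfzDr ?kappa_neq0 // expr1z.
Qed.

Lemma wtle_tmode a b n u v : wtle a u -> wtle b v -> wtle (a + b + n - 1) (tmode n u v).
Proof.
move=> au bv; apply: wtle_nsum; first exact: fin1_tmode.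
move=> k; apply: wtleZ; apply: wtle_weaken (wtle_vop (n := k%:Z - n) au bv); lia.
Qed.

Lemma wt_comp_tmode a b n u v : wt_space a u -> wt_space b v ->
  wt_comp (tmode n u v) (a + b + n - 1) = kappa ^ (1 - n) *: vop u (- n) v.
Proof.
move=> au bv; rewrite /tmode nsum_recl; last exact: fin1_tmode.
have H : wt_space (a + b + n - 1) (vop u (- n) v).
  by have := vop_wt (- n) au bv; rewrite opprK.
rewrite wt_compD wt_compZ qgpow_0 sub0r (wt_comp_hom H) eqxx -[RHS]addr0; congr (_ + _).
have L : wtle (a + b + n - 2) (nsum (fun k => (kappa * qgpow R n k.+1) *: vop u (k.+1%:Z - n) v)).
  apply: wtle_nsum; first exact: (fin1_S (fin1_tmode n u v)).
  move=> k; apply: wtleZ.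
  by apply: wtle_weaken (wtle_vop (n := k.+1%:Z - n) (wtle_hom au) (wtle_hom bv)); lia.
apply: L; lia.
Qed.

Lemma wt_comp_zmode a b n u v : wtle a u -> wtle b v ->
  wt_comp (zmode n u v) (a + b + n - 1) = vop (wt_comp u a) (- n) (wt_comp v b).
Proof.
move=> au bv; move: u au; apply: wtle_ind => [|x y Px Py|k u ka ku].
- by rewrite zmode0l !wt_comp0 vop0l.
- by rewrite zmodeDl !wt_compD Px Py vopDl.
move: v bv; apply: wtle_ind => [|x y Px Py|l v lb lv].
- by rewrite zmode0r !wt_comp0 vop0r.
- by rewrite zmodeDr !wt_compD Px Py vopDr.
have top := hmode_top (n := n) ku lv.
have H : wt_space (k + l + n - 1) (vop u (- n) v).
  by have := vop_wt (- n) ku lv; rewrite opprK.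
rewrite -[zmode n u v](subrK (vop u (- n) v)) wt_compD top ?add0r; last lia.
rewrite (wt_comp_hom ku) (wt_comp_hom lv) (wt_comp_hom H).
have [Ea|ak] := eqVneq a k; have [Eb|bl] := eqVneq b l; rewrite ?vop0l ?vop0r ?Ea ?Eb ?eqxx //.
- by case: eqP => //; lia.
- by case: eqP => //; lia.
- by case: eqP => //; lia.
Qed.

Lemma Uop_tmode n u v : Uop (tmode n u v) = zmode n (Uop u) (Uop v).
Proof.
elim/hom_ind: u n => [|x y Px Py|a u au] n.
- by rewrite tmode0l !Uop0 zmode0l.
- by rewrite tmodeDl !UopD zmodeDl Px Py.
elim/hom_ind: v n => [|x y Px Py|b v bv] n.
- by rewrite tmode0r !Uop0 zmode0r.
- by rewrite tmodeDr !UopD zmodeDr Px Py.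
pose D m := Uop (tmode m u v) - zmode m (Uop u) (Uop v).
suff D0 : forall m, D m = 0 by apply/eqP; rewrite -subr_eq0 -/(D n) D0.
have [N DN] : exists N : nat, forall m, m <= - N%:Z -> D m = 0.
  have [N1 H1] := tmode_trunc u v; have [N2 H2] := zmode_trunc (Uop u) (Uop v).
  by exists (N1 + N2)%N => m Hm; rewrite /D H1 ?H2 ?Uop0 ?subr0 //; lia.
have ED m : Eop (D m) = (a + b)%:~R *: D m
    - nsum (fun j => (c j * (j.+1%:Z - m)%:~R) *: D (m - j%:Z)).
  rewrite /D -scaleN1r EopD EopZ Eop_Uop (Lop0_tmode _ au bv) Eop_zmode !Eop_Uop.
  rewrite (Lop0_wt au) (Lop0_wt bv) !UopZ zmodeZl zmodeZr.
  have f1 : fin1 (fun j : nat => (c j * (j.+1%:Z - m)%:~R) *: Uop (tmode (m - j%:Z) u v)).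
    apply: fin1Z; have [N1 H1] := tmode_trunc u v; exists (N1 + `|m|)%N => j Hj.
    by rewrite H1 ?Uop0 //; lia.
  have f2 : fin1 (fun j : nat => (c j * (j.+1%:Z - m)%:~R) *: zmode (m - j%:Z) (Uop u) (Uop v)).
    apply: fin1Z; have [N1 H1] := zmode_trunc (Uop u) (Uop v); exists (N1 + `|m|)%N => j Hj.
    by rewrite H1 //; lia.
  rewrite [in RHS](eq_nsum (G := fun j => (c j * (j.+1%:Z - m)%:~R) *: Uop (tmode (m - j%:Z) u v)
     - (c j * (j.+1%:Z - m)%:~R) *: zmode (m - j%:Z) (Uop u) (Uop v))); last first.
    by move=> j; rewrite scalerBr.
  rewrite (nsumB f1 f2).
  have -> : Uop ((a + b)%:~R *: tmode m u v
      - nsum (fun j => (c j * (j.+1%:Z - m)%:~R) *: tmode (m - j%:Z) u v)) =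
     (a + b)%:~R *: Uop (tmode m u v)
      - nsum (fun j => (c j * (j.+1%:Z - m)%:~R) *: Uop (tmode (m - j%:Z) u v)).
    rewrite raddfB /= UopZ; congr (_ - _).
    rewrite (@nsum_morph _ _ (@Uop R V)) ?Uop0 //; last 2 first.
    - by move=> x y; rewrite UopD.
    - apply: fin1Z; have [N1 H1] := tmode_trunc u v; exists (N1 + `|m|)%N => j Hj.
      by rewrite H1 //; lia.
    by apply: eq_nsum => j /=; rewrite UopZ.
  rewrite -scalerDl -rmorphD /= [b + a]addrC !scaleN1r scalerBr !opprB.
  by rewrite addrACA [RHS]addrACA; congr (_ + _); exact: addrC.
(* The parts of weight a + b + m - 1 agree: U multiplies the top part kappa^(1-m) u_(-m) v of the
   first mode by kappa^(a+b+m-1), and the total factor kappa^(a+b) is the one contributed by the top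
   parts of [Uop u] and [Uop v]. *)
have top m : wtle (a + b + m - 2) (D m).
  have L : wtle (a + b + m - 1) (D m).
    apply: wtleB; first by apply/wtle_Uop/wtle_tmode; exact: wtle_hom.
    by apply: wtle_zmode; apply/wtle_Uop/wtle_hom.
  rewrite (_ : a + b + m - 2 = a + b + m - 1 - 1); last lia.
  apply: wtle_pred L _; rewrite /D -scaleN1r wt_compD wt_compZ.
  rewrite wt_comp_Uop; last by apply: wtle_tmode; exact: wtle_hom.
  rewrite (wt_comp_tmode _ au bv) wt_comp_zmode; try exact/wtle_Uop/wtle_hom.
  rewrite !wt_comp_Uop; try exact: wtle_hom.
  rewrite (wt_comp_hom au) (wt_comp_hom bv) !eqxx vopZl vopZr !scalerA -scalerDl.
  rewrite -!expfzDr ?kappa_neq0 // (_ : a + b + m - 1 + (1 - m) = a + b); last lia.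
  by rewrite expfzDr ?kappa_neq0 // mulN1r mulNr subrr scale0r.
have DD k : forall m, m <= - N%:Z + k%:Z -> D m = 0.
  elim: k => [|k IHk] m mk; first by apply: DN; lia.
  apply: (@Eop_eigen_eq0 _ _ (a + b + m - 1)).
    by have := top m; apply: wtle_weaken; lia.
  (* By induction only j = 0 survives, with coefficient c_0 (1 - m), so [D m] satisfies the
     eigenvector equation of E for a + b - (1 - m), one more than the weights allowed by [top]. *)
  rewrite ED (@nsum1 _ 0%N) => [|j j0]; last by rewrite IHk ?scaler0 //; lia.
  rewrite mul1r subr0 -scalerBl -rmorphB /=; congr (_%:~R *: _); lia.
by move=> m; apply: (DD (absz (m + N%:Z))); lia.
Qed.

End TildeModes.

(** * Uniqueness of quotient algebras *)

Section UniqueQuotient.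
Variables (K : pzRingType) (V : lmodType K) (O : set V) (mul : V -> V -> V) (e : V).

Lemma quot_proj_eq (A : quotient_algebra O mul e) u v :
  quot_proj A u = quot_proj A v <-> O (u - v).
Proof.
rewrite -(quot_proj_ker A) raddfB; split=> [E|]; last exact: subr0_eq.
by apply/eqP; rewrite subr_eq0; apply/eqP.
Qed.

(** Both projections have kernel O, so the choice of preimages under the first does not affect their
    images under the second. *)
Lemma quotient_algebra_unique (A B : quotient_algebra O mul e) : alg_isomorphic A B.
Proof.
have /choice[r rK] := @quot_proj_surj _ _ _ _ _ A.
have /choice[s sK] := @quot_proj_surj _ _ _ _ _ B.
pose f a := quot_proj B (r a).
have fp u : f (quot_proj A u) = quot_proj B u by apply/quot_proj_eq/(quot_proj_eq A).
have f_linear : linear f.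
  by move=> a x y; rewrite -[x]rK -[y]rK -linearP !fp linearP.
pose fL : {linear A -> B} := HB.pack f (GRing.isLinear.Build K A B *:%R f f_linear).
exists fL; split=> /=.
- exists (fun b => quot_proj A (s b)) => x; last by rewrite fp sK.
  by rewrite -[RHS]rK; apply/quot_proj_eq/(quot_proj_eq B); rewrite sK.
- by move=> x y; rewrite -[x]rK -[y]rK -quot_projM !fp quot_projM.
- by rewrite -(quot_proj1 A) fp quot_proj1.
Qed.

End UniqueQuotient.

(** * The isomorphism *)

Section TildeIsZhu.
Variables (R : realType) (V : voaType R).
Implicit Types u v w : V.

Lemma zhu_algebra_inhabited : inhabited (zhu_algebra V).
Proof.
apply: quotient_algebra_inhabited.
- exact: lspan0.
- by move=> a u v Ou Ov; apply: lspanD => //; exact: lspanZ.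
- by move=> v a x y; rewrite /zhu_mul !zhu_resE zmodeDl zmodeZl.
- by move=> u a x y; rewrite /zhu_mul !zhu_resE zmodeDr zmodeZr.
- by move=> u v Ou; rewrite /zhu_mul zhu_resE; exact: zhu_O_mull.
- by move=> u v Ov; rewrite /zhu_mul zhu_resE; exact: zhu_O_mulr.
- move=> u v w; rewrite /zhu_mul !zhu_resE -opprB; apply: lspanN.
  exact: (@zhu_O_associator _ _ 1).
- by move=> v; rewrite /zhu_mul zhu_resE zmode1_vacl subrr; exact: lspan0.
- by move=> v; rewrite /zhu_mul zhu_resE zmode1_vacr subrr; exact: lspan0.
Qed.

Lemma Uop_tilde_res (n : nat) u v : Uop (tilde_res n u v) = zhu_res n (Uop u) (Uop v).
Proof. by rewrite tilde_resE Uop_tmode. Qed.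

(** The generators differ: all orders n > 1 on one side, order 2 on the other. Images of the former
    are covered by [zhu_O_zmode]; conversely, surjectivity of U writes each generator of order 2 as
    an image, and injectivity identifies the preimage with v. *)
Lemma zhu_O_Uop v : zhu_O (Uop v) <-> tilde_O v.
Proof.
split=> [|tv]; last first.
  apply: (lspan_ind (P := fun v => zhu_O (Uop v))) tv => [|x y Ox Oy|a x Ox|].
  - by rewrite Uop0; exact: lspan0.
  - by rewrite UopD; exact: lspanD.
  - by rewrite UopZ; exact: lspanZ.
  - by move=> _ [n [u [w [n1 ->]]]]; rewrite Uop_tilde_res; exact: zhu_O_zmode.
have Uop_injective x y : Uop x = Uop y -> x = y.
  by move=> E; apply: subr0_eq; apply: Uop_inj; rewrite raddfB /= E subrr.
suff H w : zhu_O w -> exists2 x, tilde_O x & Uop x = w.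
  by move=> /H[x Ox /Uop_injective <-].
apply: (lspan_ind (P := fun w => exists2 x, tilde_O x & Uop x = w)) => [|x y [x' Ox <-] [y' Oy <-]|a x [x' Ox <-]|].
- by exists 0; [exact: lspan0|exact: Uop0].
- by exists (x' + y'); [exact: lspanD|exact: UopD].
- by exists (a *: x'); [exact: lspanZ|exact: UopZ].
move=> _ [u [v' ->]]; have [x <-] := Uop_surj u; have [y <-] := Uop_surj v'.
exists (tilde_res 2 x y); last exact: Uop_tilde_res.
by apply: lspan_sub; exists 2%N, x, y.
Qed.

(** The projection onto A composed with U has kernel [tilde_O] and turns [tilde_mul] into the
    product of A, so the same algebra serves for both quotients. *)
Lemma tilde_algebra_of_zhu (A : zhu_algebra V) :
  exists B : tilde_algebra V, quot_alg B = quot_alg A.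
Proof.
have pU : linear (fun v => quot_proj A (Uop v)) by move=> a u v; rewrite !linearP.
pose p : {linear V -> quot_alg A} :=
  HB.pack (fun v => quot_proj A (Uop v)) (GRing.isLinear.Build _ V (quot_alg A) *:%R _ pU).
unshelve eexists; first apply: (@QuotientAlgebra _ V _ _ _ (quot_alg A) p) => /=.
- move=> a; have [v <-] := quot_proj_surj a; have [u <-] := Uop_surj v.
  by exists u.
- by move=> v; rewrite quot_proj_ker; exact: zhu_O_Uop.
- by move=> u v; rewrite /tilde_mul Uop_tilde_res -quot_projM.
- by rewrite Uop_vacuum quot_proj1.
by [].
Qed.

End TildeIsZhu.

Theorem proposition6p7 (R : realType) (V : voaType R) :
  inhabited (tilde_algebra V) /\ inhabited (zhu_algebra V) /\
  forall (At : tilde_algebra V) (A : zhu_algebra V), alg_isomorphic At A.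
Proof.
have [A0] := zhu_algebra_inhabited V; have [B0 _] := tilde_algebra_of_zhu A0.
split; first by constructor.
split=> [|At A]; first by constructor.
(* B and A have the same underlying algebra, so it remains to compare two presentations of the tilde
   quotient. *)
by have [B <-] := tilde_algebra_of_zhu A; exact: quotient_algebra_unique.
Qed.
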